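(* Let $\mathcal F$ be a Frobenius category, linear over a field $K$, such that $\underline{\mathcal F}$ is hom-finite, and let $l\in\mathbb N$. Suppose that the dualized hom-functors $\mathrm{Hom}_{\underline{\mathcal F}}(A,-)^\ast\colon\underline{\mathcal F}\to\mathrm{Vect}$ are representable for all $A\in\mathcal F$. Then for any $X=(X,\alpha)\in\mathrm{Mor}^{\mathrm m}_l(\mathcal F)$ the dualized hom-functor $\mathrm{Hom}_{\mathcal M_l}(X,-)^\ast\colon\mathcal M_l\to\mathrm{Vect}$ is representable by an object $\tilde X$ obtained as follows. Consider any commutative diagram in $\mathcal F$ consisting of objects $\tilde X^{i,j}$ for $0\le i\le j\le l$ and $\tilde X^{j+1,j}:=I^j\in\mathrm{Inj}(\mathcal F)$ for $0\le j\le l-1$, horizontal morphisms $\tilde\beta^{i,j}\colon\tilde X^{i,j}\to\tilde X^{i,j+1}$ for $0\le i\le j+1\le l$, and vertical admissible monics $\tilde\alpha^{i,j}\colon\tilde X^{i,j}\to\tilde X^{i+1,j}$ (for $0\le i<j\le l$ and for $0\le i=j\le l-1$), such that for all $0\le i\le j\le l-1$ the square with corners $\tilde X^{i,j},\tilde X^{i,j+1},\tilde X^{i+1,j},\tilde X^{i+1,j+1}$ is bicartesian, and such that the first row consists of representing objects $\tilde X^{0,j}$ of $\mathrm{Hom}_{\underline{\mathcal F}}(X^j,-)^\ast$, $0\le j\le l$, and of morphisms $\tilde\beta^{0,j}\colon\tilde X^{0,j}\to\tilde X^{0,j+1}$ whose classes in $\underline{\mathcal F}$ correspond to $\alpha^j$,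 $0\le j\le l-1$. Then $\tilde X$ is the rightmost column $$\tilde X^{0,l}\xrightarrow{\tilde\alpha^{0,l}}\tilde X^{1,l}\xrightarrow{\tilde\alpha^{1,l}}\cdots\xrightarrow{\tilde\alpha^{l-1,l}}\tilde X^{l,l}.$$
   Context: A Frobenius category $\mathcal F$ is an exact category with enough projectives and enough injectives in which projective and injective objects coincide; $\underline{\mathcal F}$ is its (triangulated) stable category and $\mathrm{Inj}(\mathcal F)$ its subcategory of injectives. $\mathrm{Mor}^{\mathrm m}_l(\mathcal F)$ is the category of chains $X=(X,\alpha)\colon X^0\xrightarrow{\alpha^0}\cdots\xrightarrow{\alpha^{l-1}}X^l$ of $l$ admissible monomorphisms in $\mathcal F$, with commutative ladders as morphisms; with the termwise exact structure it is a Frobenius category whose projective-injectives are the chains of admissible monomorphisms with all terms projective. $\mathcal M_l$ is its stable category. Hom-finite means that all Hom-spaces are finite-dimensional over $K$. $\mathrm{Vect}$ is the category of $K$-vector spaces and $(-)^\ast=\mathrm{Hom}_K(-,K)$. For an object $A$ of a $K$-linear category $\mathcal T$, the contravariant functor $\mathrm{Hom}_{\mathcal T}(A,-)^\ast$ is represented by $\tilde A\in\mathcal T$ if there is an isomorphism of functors $\eta_A\colon\mathrm{Hom}_{\mathcal T}(-,\tilde A)\cong\mathrm{Hom}_{\mathcal T}(A,-)^\ast$. Given such isomorphisms $\eta_A,\eta_B$, a morphism $f\colon A\to B$ corresponds to the unique morphism $\tilde f\colon\tilde A\to\tilde B$ for which $\eta_B\circ\mathrm{Hom}_{\mathcal T}(-,\tilde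 f)=\mathrm{Hom}_{\mathcal T}(f,-)^\ast\circ\eta_A$. *)

(* Defs.v *)
From HB Require Import structures.
From mathcomp Require Import all_boot all_order all_algebra.
From mathcomp Require Import boolp.

Set Implicit Arguments.
Unset Strict Implicit.
Unset Printing Implicit Defensive.

Import GRing.Theory.

Local Open Scope ring_scope.
Local Open Scope quotient_scope.

#[local] Obligation Tactic := idtac.

Section DependentProduct.
Context (K : fieldType) (I : Type) (V : I -> lmodType K).

Definition dprodM := forall i, V i.

HB.instance Definition _ := gen_eqMixin dprodM.
HB.instance Definition _ := gen_choiceMixin dprodM.

Let add (f g : dprodM) : dprodM := fun i => f i + g i.
Let opp (f : dprodM) : dprodM := fun i => - f i.
Let scl (a : K) (f : dprodM) : dprodM := fun i => a *: f i.

Fact dprodM_addA : associative add.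
Proof. by move=> f g h; apply: functional_extensionality_dep => i; exact: addrA. Qed.
Fact dprodM_addC : commutative add.
Proof. by move=> f g; apply: functional_extensionality_dep => i; exact: addrC. Qed.
Fact dprodM_add0 : left_id ((fun=> 0) : dprodM) add.
Proof. by move=> f; apply: functional_extensionality_dep => i; exact: add0r. Qed.
Fact dprodM_addN : left_inverse ((fun=> 0) : dprodM) opp add.
Proof. by move=> f; apply: functional_extensionality_dep => i; exact: addNr. Qed.

HB.instance Definition _ :=
  GRing.isZmodule.Build dprodM dprodM_addA dprodM_addC dprodM_add0 dprodM_addN.

Fact dprodM_scalerA a b (f : dprodM) : scl a (scl b f) = scl (a * b) f.
Proof. by apply: functional_extensionality_dep => i; exact: scalerA. Qed.
Fact dprodM_scale1r : left_id 1 scl.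
Proof. by move=> f; apply: functional_extensionality_dep => i; exact: scale1r. Qed.
Fact dprodM_scalerDr : right_distributive scl +%R.
Proof. by move=> a f g; apply: functional_extensionality_dep => i; exact: scalerDr. Qed.
Fact dprodM_scalerDl (f : dprodM) : {morph scl^~ f : a b / a + b}.
Proof. by move=> a b; apply: functional_extensionality_dep => i; exact: scalerDl. Qed.

HB.instance Definition _ :=
  GRing.Zmodule_isLmodule.Build K dprodM
    dprodM_scalerA dprodM_scale1r dprodM_scalerDr dprodM_scalerDl.

End DependentProduct.

Section Dual.
Context (K : fieldType) (V : lmodType K).

Definition dual := {linear V -> K^o}.

Lemma dual_ext (f g : dual) : f =1 g -> f = g.
Proof.
case: f g => [f [[cf] [cf']]] [g [[cg] [cg']]] /= /funext fg.
by case: _ / fg in cg cg' *; rewrite (Prop_irrelevance cf cg) (Prop_irrelevance cf' cg').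
Qed.

HB.instance Definition _ := gen_eqMixin dual.
HB.instance Definition _ := gen_choiceMixin dual.

Let zero : dual := \0.
Let add (f g : dual) : dual := f \+ g.
Let opp (f : dual) : dual := GRing.opp_fun f.
Let scl (a : K) (f : dual) : dual := a \*: f.

Fact dual_addA : associative add.
Proof. by move=> f g h; apply: dual_ext => v; exact: addrA. Qed.
Fact dual_addC : commutative add.
Proof. by move=> f g; apply: dual_ext => v; exact: addrC. Qed.
Fact dual_add0 : left_id zero add.
Proof. by move=> f; apply: dual_ext => v; exact: add0r. Qed.
Fact dual_addN : left_inverse zero opp add.
Proof. by move=> f; apply: dual_ext => v; exact: addNr. Qed.

HB.instance Definition _ :=
  GRing.isZmodule.Build dual dual_addA dual_addC dual_add0 dual_addN.

Fact dual_scalerA a b (f : dual) : scl a (scl b f) = scl (a * b) f.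
Proof. by apply: dual_ext => v; exact: scalerA. Qed.
Fact dual_scale1r : left_id 1 scl.
Proof. by move=> f; apply: dual_ext => v; exact: scale1r. Qed.
Fact dual_scalerDr : right_distributive scl +%R.
Proof. by move=> a f g; apply: dual_ext => v; exact: scalerDr. Qed.
Fact dual_scalerDl (f : dual) : {morph scl^~ f : a b / a + b}.
Proof. by move=> a b; apply: dual_ext => v; exact: scalerDl. Qed.

HB.instance Definition _ :=
  GRing.Zmodule_isLmodule.Build K dual
    dual_scalerA dual_scale1r dual_scalerDr dual_scalerDl.

End Dual.

Section Transpose.
Context (K : fieldType) (V W : lmodType K) (u : {linear V -> W}).

Definition transpose (f : dual W) : dual V := f \o u.

Fact transpose_linear : linear transpose.
Proof. by move=> a f g; apply: dual_ext. Qed.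

HB.instance Definition _ :=
  GRing.isLinear.Build K (dual W) (dual V) *:%R transpose transpose_linear.

End Transpose.

Definition fin_dim (K : fieldType) (V : lmodType K) :=
  exists (n : nat) (e : 'I_n -> V),
    forall v : V, exists c : 'I_n -> K, v = \sum_i c i *: e i.

Record submodule (K : fieldType) (V : lmodType K) := Submodule {
  sub_mem :> V -> Prop;
  sub_mem0 : sub_mem 0;
  sub_memD : forall u v, sub_mem u -> sub_mem v -> sub_mem (u + v);
  sub_memZ : forall a v, sub_mem v -> sub_mem (a *: v) }.

Section Quotient.
Context (K : fieldType) (V : lmodType K) (S : submodule V).

Let sub_memN v : S v -> S (- v).
Proof. by rewrite -scaleN1r; exact: sub_memZ. Qed.

Definition quot_rel : rel V := fun u v => `[< S (u - v) >].

Fact quot_rel_refl : reflexive quot_rel.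
Proof. by move=> u; apply/asboolP; rewrite subrr; exact: sub_mem0. Qed.
Fact quot_rel_sym : symmetric quot_rel.
Proof.
by move=> u v; apply/asboolP/asboolP => /sub_memN; rewrite opprB.
Qed.
Fact quot_rel_trans : transitive quot_rel.
Proof.
move=> v u w /asboolP uv /asboolP vw; apply/asboolP.
by rewrite -(subrK v u) -addrA; exact: sub_memD.
Qed.

Canonical quot_equiv := EquivRel quot_rel quot_rel_refl quot_rel_sym quot_rel_trans.

Definition quotM := {eq_quot quot_equiv}.
HB.instance Definition _ := Choice.on quotM.
HB.instance Definition _ := EqQuotient.on quotM.

Definition quot_pi (v : V) : quotM := \pi_quotM v.

Lemma quot_piE u v : quot_pi u = quot_pi v <-> S (u - v).
Proof.
split=> [/eqmodP/asboolP //|uv]; apply/eqmodP; exact/asboolP.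
Qed.

Lemma quot_reprK (x : quotM) : quot_pi (repr x) = x.
Proof. exact: reprK. Qed.

Lemma quot_repr v : S (repr (quot_pi v) - v).
Proof. by apply/quot_piE; rewrite quot_reprK. Qed.

Let add (x y : quotM) : quotM := quot_pi (repr x + repr y).
Let opp (x : quotM) : quotM := quot_pi (- repr x).
Let scl (a : K) (x : quotM) : quotM := quot_pi (a *: repr x).

Let addE u v : add (quot_pi u) (quot_pi v) = quot_pi (u + v).
Proof. by apply/quot_piE; rewrite opprD addrACA; apply: sub_memD; exact: quot_repr. Qed.
Let oppE u : opp (quot_pi u) = quot_pi (- u).
Proof. by apply/quot_piE; rewrite -opprD; apply: sub_memN; exact: quot_repr. Qed.
Let sclE a u : scl a (quot_pi u) = quot_pi (a *: u).
Proof. by apply/quot_piE; rewrite -scalerBr; apply: sub_memZ; exact: quot_repr. Qed.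

Fact quotM_addA : associative add.
Proof.
by move=> x y z; rewrite -(quot_reprK x) -(quot_reprK y) -(quot_reprK z) !addE addrA.
Qed.
Fact quotM_addC : commutative add.
Proof. by move=> x y; rewrite -(quot_reprK x) -(quot_reprK y) !addE addrC. Qed.
Fact quotM_add0 : left_id (quot_pi 0) add.
Proof. by move=> x; rewrite -(quot_reprK x) addE add0r. Qed.
Fact quotM_addN : left_inverse (quot_pi 0) opp add.
Proof. by move=> x; rewrite -(quot_reprK x) oppE addE addNr. Qed.

HB.instance Definition _ :=
  GRing.isZmodule.Build quotM quotM_addA quotM_addC quotM_add0 quotM_addN.

Fact quotM_scalerA a b (x : quotM) : scl a (scl b x) = scl (a * b) x.
Proof. by rewrite -(quot_reprK x) !sclE scalerA. Qed.
Fact quotM_scale1r : left_id 1 scl.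
Proof. by move=> x; rewrite -(quot_reprK x) sclE scale1r. Qed.
Fact quotM_scalerDr : right_distributive scl +%R.
Proof.
by move=> a x y; rewrite -(quot_reprK x) -(quot_reprK y) [X in scl a X]addE !sclE
  [RHS]addE scalerDr.
Qed.
Fact quotM_scalerDl (x : quotM) : {morph scl^~ x : a b / a + b}.
Proof.
by move=> a b; rewrite -(quot_reprK x) !sclE [RHS]addE scalerDl.
Qed.

HB.instance Definition _ :=
  GRing.Zmodule_isLmodule.Build K quotM
    quotM_scalerA quotM_scale1r quotM_scalerDr quotM_scalerDl.

Fact quot_pi_linear : linear quot_pi.
Proof. by move=> a u v; rewrite -[LHS]addE -sclE. Qed.

HB.instance Definition _ :=
  GRing.isLinear.Build K V quotM *:%R quot_pi quot_pi_linear.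

End Quotient.

Record linCat (K : fieldType) := LinCat {
  obj :> Type;
  hom : obj -> obj -> lmodType K;
  idm : forall A, hom A A;
  comp : forall A B C, hom B C -> hom A B -> hom A C;
  comp_idl : forall A B (f : hom A B), comp (idm B) f = f;
  comp_idr : forall A B (f : hom A B), comp f (idm A) = f;
  comp_assoc : forall A B C D (h : hom C D) (g : hom B C) (f : hom A B),
    comp h (comp g f) = comp (comp h g) f;
  comp_linl : forall A B C (f : hom A B) a (g g' : hom B C),
    comp (a *: g + g') f = a *: comp g f + comp g' f;
  comp_linr : forall A B C (g : hom B C) a (f f' : hom A B),
    comp g (a *: f + f') = a *: comp g f + comp g f' }.

Arguments hom {K C} A B : rename.
Arguments idm {K C} A : rename.
Arguments comp {K C A B C0} g f : rename.

Notation "g \oc f" := (comp g f) (at level 40, left associativity).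

Section LinCatTheory.
Context (K : fieldType) (C : linCat K).
Implicit Types A B : C.

Lemma compDl A B D (g g' : hom B D) (f : hom A B) :
  (g + g') \oc f = g \oc f + g' \oc f.
Proof. by have := comp_linl f 1 g g'; rewrite !scale1r. Qed.

Lemma compDr A B D (g : hom B D) (f f' : hom A B) :
  g \oc (f + f') = g \oc f + g \oc f'.
Proof. by have := comp_linr g 1 f f'; rewrite !scale1r. Qed.

Lemma comp0l A B D (f : hom A B) : (0 : hom B D) \oc f = 0.
Proof. by apply: (addrI (0 \oc f)); rewrite -compDl !addr0. Qed.

Lemma comp0r A B D (g : hom B D) : g \oc (0 : hom A B) = 0.
Proof. by apply: (addrI (g \oc 0)); rewrite -compDr !addr0. Qed.

Lemma compZl A B D a (g : hom B D) (f : hom A B) : (a *: g) \oc f = a *: (g \oc f).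
Proof. by have := comp_linl f a g 0; rewrite comp0l !addr0. Qed.

Lemma compZr A B D a (g : hom B D) (f : hom A B) : g \oc (a *: f) = a *: (g \oc f).
Proof. by have := comp_linr g a f 0; rewrite comp0r !addr0. Qed.

Lemma compNl A B D (g : hom B D) (f : hom A B) : (- g) \oc f = - (g \oc f).
Proof. by rewrite -scaleN1r compZl scaleN1r. Qed.

Lemma compNr A B D (g : hom B D) (f : hom A B) : g \oc (- f) = - (g \oc f).
Proof. by rewrite -scaleN1r compZr scaleN1r. Qed.

Lemma compBl A B D (g g' : hom B D) (f : hom A B) :
  (g - g') \oc f = g \oc f - g' \oc f.
Proof. by rewrite compDl compNl. Qed.

Lemma compBr A B D (g : hom B D) (f f' : hom A B) :
  g \oc (f - f') = g \oc f - g \oc f'.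
Proof. by rewrite compDr compNr. Qed.

Definition postcomp A B D (g : hom B D) : hom A B -> hom A D := fun f => g \oc f.
Definition precomp A B D (f : hom A B) : hom B D -> hom A D := fun g => g \oc f.

Fact postcomp_linear A B D (g : hom B D) : linear (@postcomp A B D g).
Proof. by move=> a f f'; exact: comp_linr. Qed.
HB.instance Definition _ A B D (g : hom B D) :=
  GRing.isLinear.Build K (hom A B) (hom A D) *:%R (postcomp g) (postcomp_linear g).

Fact precomp_linear A B D (f : hom A B) : linear (@precomp A B D f).
Proof. by move=> a g g'; exact: comp_linl. Qed.
HB.instance Definition _ A B D (f : hom A B) :=
  GRing.isLinear.Build K (hom B D) (hom A D) *:%R (precomp f) (precomp_linear f).

Definition is_iso A B (f : hom A B) :=
  exists g : hom B A, g \oc f = idm A /\ f \oc g = idm B.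

Definition is_zero A := forall B, (forall f : hom A B, f = 0) /\ (forall f : hom B A, f = 0).

Record biproduct A B := Biproduct {
  bp_ob :> C;
  bp_inl : hom A bp_ob;
  bp_inr : hom B bp_ob;
  bp_prl : hom bp_ob A;
  bp_prr : hom bp_ob B;
  bp_ll : bp_prl \oc bp_inl = idm A;
  bp_rr : bp_prr \oc bp_inr = idm B;
  bp_lr : bp_prl \oc bp_inr = 0;
  bp_rl : bp_prr \oc bp_inl = 0;
  bp_id : bp_inl \oc bp_prl + bp_inr \oc bp_prr = idm bp_ob }.

Definition additive_cat :=
  (exists Z, is_zero Z) /\ forall A B, inhabited (biproduct A B).

Definition is_kernel A B D (i : hom A B) (p : hom B D) :=
  p \oc i = 0 /\
  forall T (f : hom T B), p \oc f = 0 -> exists! g : hom T A, i \oc g = f.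

Definition is_cokernel A B D (i : hom A B) (p : hom B D) :=
  p \oc i = 0 /\
  forall T (f : hom B T), f \oc i = 0 -> exists! g : hom D T, g \oc p = f.

(* The square
        A --h--> B
        |        |
        v        w
        |        |
        A' -h'-> B'                                                       *)
Definition is_pushout A B A' B' (h : hom A B) (v : hom A A') (w : hom B B')
    (h' : hom A' B') :=
  w \oc h = h' \oc v /\
  forall T (b : hom B T) (a' : hom A' T), b \oc h = a' \oc v ->
    exists! g : hom B' T, g \oc w = b /\ g \oc h' = a'.

Definition is_pullback A B A' B' (h : hom A B) (v : hom A A') (w : hom B B')
    (h' : hom A' B') :=
  w \oc h = h' \oc v /\
  forall T (b : hom T B) (a' : hom T A'), w \oc b = h' \oc a' ->
    exists! g : hom T A, h \oc g = b /\ v \oc g = a'.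

Definition bicartesian A B A' B' (h : hom A B) (v : hom A A') (w : hom B B')
    (h' : hom A' B') :=
  is_pushout h v w h' /\ is_pullback h v w h'.

End LinCatTheory.

Definition hom_finite (K : fieldType) (C : linCat K) :=
  forall A B : C, fin_dim (hom A B).

Record presheaf (K : fieldType) (C : linCat K) := Presheaf {
  psh_ob :> C -> lmodType K;
  psh_map : forall A B : C, hom A B -> {linear psh_ob B -> psh_ob A};
  psh_id : forall (A : C) (x : psh_ob A), psh_map (idm A) x = x;
  psh_comp : forall (A B D : C) (g : hom B D) (f : hom A B) (x : psh_ob D),
    psh_map (g \oc f) x = psh_map f (psh_map g x) }.

Arguments psh_map {K C} P {A B} f : rename.

Record natIso (K : fieldType) (C : linCat K) (P Q : presheaf C) := NatIso {
  nat_map :> forall A : C, {linear P A -> Q A};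
  nat_bij : forall A, bijective (nat_map A);
  nat_natural : forall (A B : C) (f : hom A B) (x : P B),
    nat_map A (psh_map P f x) = psh_map Q f (nat_map B x) }.

Section DualHom.
Context (K : fieldType) (C : linCat K).
Implicit Types A B Y : C.

Program Definition hom_to (At : C) : presheaf C :=
  @Presheaf K C (fun Y => hom Y At) (fun Y Y' f => [the {linear _ -> _} of precomp f]) _ _.
Next Obligation. by move=> *; rewrite /= /precomp comp_idr. Qed.
Next Obligation. by move=> *; rewrite /= /precomp comp_assoc. Qed.

Program Definition dual_hom (A : C) : presheaf C :=
  @Presheaf K C (fun Y => dual (hom A Y))
    (fun Y Y' f => [the {linear _ -> _} of transpose (postcomp f)]) _ _.
Next Obligation.
by move=> A Y x; apply: dual_ext => g /=; rewrite /postcomp comp_idl.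
Qed.
Next Obligation.
by move=> A Y Y' Y'' g f x; apply: dual_ext => h /=; rewrite /postcomp comp_assoc.
Qed.

(* The component at Y of Hom(f, -)^* : Hom(A, -)^* -> Hom(B, -)^*. *)
Definition dual_hom_map A B (f : hom A B) Y :
  {linear dual_hom A Y -> dual_hom B Y} := transpose (precomp f).

Definition represents A At := natIso (hom_to At) (dual_hom A).

Definition representable A := exists At, inhabited (represents A At).

Definition corresponds A B At Bt (etaA : represents A At) (etaB : represents B Bt)
    (f : hom A B) (ft : hom At Bt) :=
  forall Y (g : hom Y At), etaB Y (ft \oc g) = dual_hom_map f Y (etaA Y g).

End DualHom.

(* An additive linear category with a class of distinguished composable pairs,
   not yet required to satisfy the axioms of an exact structure. *)
Record preExactCat (K : fieldType) := PreExactCat {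
  pre_cat :> linCat K;
  pre_additive : additive_cat pre_cat;
  conflation : forall A B D : pre_cat, hom A B -> hom B D -> Prop }.

Arguments conflation {K E A B D} i p : rename.

Section PreExact.
Context (K : fieldType) (E : preExactCat K).
Implicit Types A B D I P : E.

Definition adm_mono A B (i : hom A B) := exists D (p : hom B D), conflation i p.

Definition adm_epi B D (p : hom B D) := exists A (i : hom A B), conflation i p.

Definition injective_ob I :=
  forall A B (i : hom A B), adm_mono i ->
    forall f : hom A I, exists g : hom B I, g \oc i = f.

Definition projective_ob P :=
  forall B D (p : hom B D), adm_epi p ->
    forall f : hom P D, exists g : hom P B, p \oc g = f.

(* Quillen's axioms. *)
Record exact_axioms : Prop := ExactAxioms {
  conflation_ker : forall A B D (i : hom A B) (p : hom B D),
    conflation i p -> is_kernel i p;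
  conflation_coker : forall A B D (i : hom A B) (p : hom B D),
    conflation i p -> is_cokernel i p;
  conflation_iso : forall A B D A' B' D' (i : hom A B) (p : hom B D)
      (i' : hom A' B') (p' : hom B' D') (a : hom A A') (b : hom B B') (d : hom D D'),
    is_iso a -> is_iso b -> is_iso d ->
    b \oc i = i' \oc a -> d \oc p = p' \oc b ->
    conflation i p -> conflation i' p';
  adm_mono_id : forall A, adm_mono (idm A);
  adm_epi_id : forall A, adm_epi (idm A);
  adm_mono_comp : forall A B D (i : hom A B) (j : hom B D),
    adm_mono i -> adm_mono j -> adm_mono (j \oc i);
  adm_epi_comp : forall A B D (p : hom A B) (q : hom B D),
    adm_epi p -> adm_epi q -> adm_epi (q \oc p);
  adm_mono_pushout : forall A B A' (i : hom A B) (f : hom A A'), adm_mono i ->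
    exists B' (i' : hom A' B') (f' : hom B B'), is_pushout f i i' f' /\ adm_mono i';
  adm_epi_pullback : forall B D D' (p : hom B D) (f : hom D' D), adm_epi p ->
    exists B' (p' : hom B' D') (f' : hom B' B), is_pullback f' p' p f /\ adm_epi p' }.

End PreExact.

Record exactCat (K : fieldType) := ExactCat {
  exact_pre :> preExactCat K;
  exactP : exact_axioms exact_pre }.

Record frobeniusCat (K : fieldType) := FrobeniusCat {
  frob_exact :> exactCat K;
  enough_projectives : forall A : frob_exact,
    exists (P : frob_exact) (p : hom P A), projective_ob P /\ adm_epi p;
  enough_injectives : forall A : frob_exact,
    exists (I : frob_exact) (i : hom A I), injective_ob I /\ adm_mono i;
  projective_injective : forall P : frob_exact, projective_ob P <-> injective_ob P }.

(* The axioms of an exact structure do not enter the construction, so it is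
   given for any additive category with distinguished pairs. In a Frobenius
   category the injective objects are also the projective ones. *)

Section Stable.
Context (K : fieldType) (E : preExactCat K).
Implicit Types A B D : E.

Definition factors_inj A B (f : hom A B) :=
  exists (I : E) (g : hom A I) (h : hom I B), injective_ob I /\ f = h \oc g.

Lemma injective_bp I J (S : biproduct I J) :
  injective_ob (I : E) -> injective_ob (J : E) -> injective_ob (S : E).
Proof.
move=> injI injJ A B i mi f.
have [g gi] := injI _ _ i mi (bp_prl S \oc f).
have [h hi] := injJ _ _ i mi (bp_prr S \oc f).
exists (bp_inl S \oc g + bp_inr S \oc h).
by rewrite compDl -!comp_assoc gi hi !comp_assoc -compDl bp_id comp_idl.
Qed.

Lemma injective_zero (Z : E) : is_zero Z -> injective_ob Z.
Proof.
by move=> Z0 A B i _ f; exists 0; rewrite comp0l [RHS](Z0 A).2.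
Qed.

Fact factors_inj0 A B : factors_inj (0 : hom A B).
Proof.
have [[Z Z0] _] := pre_additive E.
exists Z, 0, 0; split; last by rewrite comp0l.
exact: injective_zero.
Qed.

Fact factors_injD A B (f f' : hom A B) :
  factors_inj f -> factors_inj f' -> factors_inj (f + f').
Proof.
move=> [I [g [h [injI ->]]]] [J [g' [h' [injJ ->]]]].
have [S] := (pre_additive E).2 I J.
exists S, (bp_inl S \oc g + bp_inr S \oc g'), (h \oc bp_prl S + h' \oc bp_prr S).
split; first exact: injective_bp.
rewrite compDl !compDr -!comp_assoc.
rewrite !(comp_assoc (bp_prl S)) !(comp_assoc (bp_prr S)).
by rewrite bp_ll bp_lr bp_rl bp_rr !comp_idl !comp0l !comp0r addr0 add0r.
Qed.

Fact factors_injZ A B a (f : hom A B) : factors_inj f -> factors_inj (a *: f).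
Proof.
by move=> [I [g [h [injI ->]]]]; exists I, g, (a *: h); rewrite compZl.
Qed.

(* No span is needed: the morphisms factoring through an injective object are
   closed under sums because injective objects have injective biproducts. *)
Definition inj_ideal A B : submodule (hom A B) :=
  Submodule (@factors_inj0 A B) (@factors_injD A B) (@factors_injZ A B).

Lemma inj_ideal_compl A B D (g : hom B D) (f : hom A B) :
  inj_ideal A B f -> inj_ideal A D (g \oc f).
Proof.
by move=> [I [u [v [injI ->]]]]; exists I, u, (g \oc v); rewrite comp_assoc.
Qed.

Lemma inj_ideal_compr A B D (g : hom B D) (f : hom A B) :
  inj_ideal B D g -> inj_ideal A D (g \oc f).
Proof.
by move=> [I [u [v [injI ->]]]]; exists I, (u \oc f), v; rewrite comp_assoc.
Qed.

Definition stable_hom A B : lmodType K := quotM (inj_ideal A B).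

Definition stable_cl A B (f : hom A B) : stable_hom A B := quot_pi (inj_ideal A B) f.

Definition stable_comp A B D (g : stable_hom B D) (f : stable_hom A B) :
  stable_hom A D := stable_cl (repr g \oc repr f).

Lemma stable_compE A B D (g : hom B D) (f : hom A B) :
  stable_comp (stable_cl g) (stable_cl f) = stable_cl (g \oc f).
Proof.
apply/quot_piE; set g' := repr _; set f' := repr _.
have -> : g' \oc f' - g \oc f = g' \oc (f' - f) + (g' - g) \oc f.
  by rewrite compBr compBl addrA subrK.
apply: sub_memD.
  by apply: inj_ideal_compl; exact: quot_repr.
by apply: inj_ideal_compr; exact: quot_repr.
Qed.

Fact stable_clP A B (f : stable_hom A B) : exists f0, f = stable_cl f0.
Proof. by exists (repr f); rewrite /stable_cl quot_reprK. Qed.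

Fact stable_clD A B a (f g : hom A B) :
  a *: stable_cl f + stable_cl g = stable_cl (a *: f + g).
Proof. by rewrite /stable_cl linearP. Qed.

Program Definition stable : linCat K :=
  @LinCat K E stable_hom (fun A => stable_cl (idm A)) stable_comp _ _ _ _ _.
Next Obligation.
by move=> A B f; have [f0 ->] := stable_clP f; rewrite stable_compE comp_idl.
Qed.
Next Obligation.
by move=> A B f; have [f0 ->] := stable_clP f; rewrite stable_compE comp_idr.
Qed.
Next Obligation.
move=> A B D D' h g f; have [[h0 ->] [g0 ->] [f0 ->]] :=
  And3 (stable_clP h) (stable_clP g) (stable_clP f).
by rewrite !stable_compE comp_assoc.
Qed.
Next Obligation.
move=> A B D f a g g'; have [[f0 ->] [g0 ->] [g1 ->]] :=
  And3 (stable_clP f) (stable_clP g) (stable_clP g').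
by rewrite stable_clD !stable_compE stable_clD comp_linl.
Qed.
Next Obligation.
move=> A B D g a f f'; have [[g0 ->] [f0 ->] [f1 ->]] :=
  And3 (stable_clP g) (stable_clP f) (stable_clP f').
by rewrite stable_clD !stable_compE stable_clD comp_linr.
Qed.

End Stable.

(* For i : 'I_l, the elements i and i + 1 of 'I_l.+1; the value of the latter
   is convertible to i.+1. *)
Notation ch_src i := (widen_ord (leqnSn _) i).
Notation ch_tgt i := (lift ord0 i).

Section DirectSumOfMonos.
Context (K : fieldType) (F : exactCat K).
Implicit Types A B : F.

Lemma is_iso_id A : is_iso (idm A).
Proof. by exists (idm A); rewrite comp_idl. Qed.

Lemma adm_mono_iso A B B' (i : hom A B) (b : hom B B') :
  is_iso b -> adm_mono i -> adm_mono (b \oc i).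
Proof.
move=> bP [D [p ip]]; have [b' [b'b bb']] := bP; exists D, (p \oc b').
apply: (conflation_iso (exactP F) (is_iso_id A) bP (is_iso_id D) _ _ ip).
  by rewrite comp_idr.
by rewrite comp_idl -comp_assoc b'b comp_idr.
Qed.

Lemma pushout_adm_mono A B A' B' (f : hom A A') (i : hom A B) (i' : hom A' B')
    (f' : hom B B') : is_pushout f i i' f' -> adm_mono i -> adm_mono i'.
Proof.
move=> [sq univ] mi.
have [P [j [g [[sqP univP] mj]]]] := adm_mono_pushout (exactP F) f mi.
have [u [[uj ug] _]] := univP _ _ _ sq.
have [v [[vi vf] _]] := univ _ _ _ sqP.
suff uP : is_iso u by rewrite -uj; exact: adm_mono_iso.
exists v; split.
  have [w [_ wu]] := univP _ _ _ sqP.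
  by rewrite -(wu (idm P)) ?comp_idl//; apply/esym/wu; rewrite -!comp_assoc uj ug.
have [w [_ wu]] := univ _ _ _ sq.
by rewrite -(wu (idm B')) ?comp_idl//; apply/esym/wu; rewrite -!comp_assoc vi vf.
Qed.

Definition bp_map A B A' B' (S : biproduct A A') (T : biproduct B B')
    (f : hom A B) (f' : hom A' B') : hom S T :=
  bp_inl T \oc f \oc bp_prl S + bp_inr T \oc f' \oc bp_prr S.

Definition bp_swap A B (S : biproduct A B) : biproduct B A :=
  Biproduct (bp_rr S) (bp_ll S) (bp_rl S) (bp_lr S)
    (etrans (addrC _ _) (bp_id S)).

Lemma bp_ext A B D (S : biproduct A B) (f g : hom S D) :
  f \oc bp_inl S = g \oc bp_inl S -> f \oc bp_inr S = g \oc bp_inr S -> f = g.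
Proof.
move=> l r; rewrite -(comp_idr f) -(comp_idr g) -bp_id !compDr !comp_assoc.
by rewrite l r.
Qed.

Lemma bp_map_inl A B A' B' (S : biproduct A A') (T : biproduct B B')
    (f : hom A B) (f' : hom A' B') :
  bp_map S T f f' \oc bp_inl S = bp_inl T \oc f.
Proof.
by rewrite /bp_map compDl -!comp_assoc bp_ll bp_rl !comp0r addr0 comp_idr.
Qed.

Lemma bp_map_inr A B A' B' (S : biproduct A A') (T : biproduct B B')
    (f : hom A B) (f' : hom A' B') :
  bp_map S T f f' \oc bp_inr S = bp_inr T \oc f'.
Proof.
by rewrite /bp_map compDl -!comp_assoc bp_lr bp_rr !comp0r add0r comp_idr.
Qed.

Lemma bp_map_prl A B A' B' (S : biproduct A A') (T : biproduct B B')
    (f : hom A B) (f' : hom A' B') :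
  bp_prl T \oc bp_map S T f f' = f \oc bp_prl S.
Proof.
by rewrite /bp_map compDr !comp_assoc bp_ll bp_lr !comp0l addr0 comp_idl.
Qed.

Lemma bp_map_prr A B A' B' (S : biproduct A A') (T : biproduct B B')
    (f : hom A B) (f' : hom A' B') :
  bp_prr T \oc bp_map S T f f' = f' \oc bp_prr S.
Proof.
by rewrite /bp_map compDr !comp_assoc bp_rr bp_rl !comp0l add0r comp_idl.
Qed.

Lemma bp_map_swap A B A' B' (S : biproduct A A') (T : biproduct B B')
    (f : hom A B) (f' : hom A' B') :
  bp_map (bp_swap S) (bp_swap T) f' f = bp_map S T f f'.
Proof. exact: addrC. Qed.

Lemma bp_map_comp A B D A' B' D' (S : biproduct A A') (T : biproduct B B')
    (U : biproduct D D') (g : hom B D) (g' : hom B' D') (f : hom A B) (f' : hom A' B') :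
  bp_map T U g g' \oc bp_map S T f f' = bp_map S U (g \oc f) (g' \oc f').
Proof.
apply: bp_ext; rewrite -comp_assoc !(bp_map_inl, bp_map_inr) comp_assoc.
  by rewrite bp_map_inl comp_assoc.
by rewrite bp_map_inr comp_assoc.
Qed.

Lemma bp_map_id_pushout A B A' (S : biproduct A A') (T : biproduct B A') (i : hom A B) :
  is_pushout (bp_inl S) i (bp_map S T i (idm A')) (bp_inl T).
Proof.
split=> [|D b a' ba']; first by rewrite bp_map_inl.
exists (a' \oc bp_prl T + b \oc bp_inr S \oc bp_prr T).
have l : (a' \oc bp_prl T + b \oc bp_inr S \oc bp_prr T) \oc bp_inl T = a'.
  by rewrite compDl -!comp_assoc bp_ll bp_rl !comp0r addr0 comp_idr.
have r : (a' \oc bp_prl T + b \oc bp_inr S \oc bp_prr T) \oc bp_inr T =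
    b \oc bp_inr S.
  by rewrite compDl -!comp_assoc bp_lr bp_rr !comp0r add0r comp_idr.
split; first split => //.
  apply: bp_ext; rewrite -comp_assoc !(bp_map_inl, bp_map_inr) comp_assoc ?l ?ba' //.
  by rewrite r comp_idr.
move=> g [gb ga']; apply: bp_ext; rewrite ?l ?r ?ga' //.
by rewrite -gb -comp_assoc bp_map_inr comp_idr.
Qed.

Lemma bp_map_adm_mono A B A' B' (S : biproduct A A') (T : biproduct B B')
    (i : hom A B) (i' : hom A' B') :
  adm_mono i -> adm_mono i' -> adm_mono (bp_map S T i i').
Proof.
move=> mi mi'; have [M] := (pre_additive F).2 B A'.
rewrite -(comp_idl i) -(comp_idr i') -(bp_map_comp S M T).
apply: (adm_mono_comp (exactP F)).
  exact: pushout_adm_mono (bp_map_id_pushout S M i) mi.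
rewrite -bp_map_swap.
exact: pushout_adm_mono (bp_map_id_pushout (bp_swap M) (bp_swap T) i') mi'.
Qed.

End DirectSumOfMonos.

Section Chains.
Context (K : fieldType) (F : exactCat K) (l : nat).

Record chain := Chain {
  ch_ob :> 'I_l.+1 -> F;
  ch_map : forall i : 'I_l, hom (ch_ob (ch_src i)) (ch_ob (ch_tgt i));
  ch_mono : forall i, adm_mono (ch_map i) }.

Section ChainHom.
Variables X Y : chain.

Definition ladder (f : dprodM (fun i => hom (X i) (Y i))) :=
  `[< forall i : 'I_l, f (ch_tgt i) \oc ch_map X i = ch_map Y i \oc f (ch_src i) >].

Fact ladder_submod : submod_closed ladder.
Proof.
split=> [|a f g /asboolP cf /asboolP cg]; apply/asboolP => i.
  by rewrite comp0l comp0r.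
by rewrite [LHS]comp_linl [RHS]comp_linr cf cg.
Qed.
HB.instance Definition _ := GRing.isSubmodClosed.Build K _ ladder ladder_submod.

Record chain_hom := ChainHom {
  chain_comp : dprodM (fun i => hom (X i) (Y i));
  chain_ladder : ladder chain_comp }.

HB.instance Definition _ := [isSub for chain_comp].
HB.instance Definition _ := [Choice of chain_hom by <:].
HB.instance Definition _ := [SubChoice_isSubLmodule of chain_hom by <:].

Definition chain_fun (f : chain_hom) : forall i, hom (X i) (Y i) := chain_comp f.
Coercion chain_fun : chain_hom >-> Funclass.

Lemma chain_homP (f : chain_hom) (i : 'I_l) :
  f (ch_tgt i) \oc ch_map X i = ch_map Y i \oc f (ch_src i).
Proof. exact: (asboolP _ (chain_ladder f)). Qed.

Lemma chain_hom_ext (f g : chain_hom) : (forall i, f i = g i) -> f = g.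
Proof. by move=> fg; apply: val_inj; exact: functional_extensionality_dep. Qed.

Definition mk_chain_hom (f : forall i, hom (X i) (Y i))
    (fP : forall i : 'I_l, f (ch_tgt i) \oc ch_map X i = ch_map Y i \oc f (ch_src i)) :
  chain_hom := ChainHom (asboolT fP).

End ChainHom.

Program Definition chainCat : linCat K :=
  @LinCat K chain (fun X Y => chain_hom X Y)
    (fun X => @mk_chain_hom X X (fun i => idm (X i)) _)
    (fun X Y Z g f => @mk_chain_hom X Z (fun i => g i \oc f i) _) _ _ _ _ _.
Next Obligation. by move=> X i; rewrite comp_idl comp_idr. Qed.
Next Obligation.
by move=> X Y Z g f i; rewrite -comp_assoc chain_homP !comp_assoc chain_homP.
Qed.
Next Obligation. by move=> X Y f; apply: chain_hom_ext => i; exact: comp_idl. Qed.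
Next Obligation. by move=> X Y f; apply: chain_hom_ext => i; exact: comp_idr. Qed.
Next Obligation.
by move=> X Y Z W h g f; apply: chain_hom_ext => i; exact: comp_assoc.
Qed.
Next Obligation.
by move=> X Y Z f a g g'; apply: chain_hom_ext => i; exact: comp_linl.
Qed.
Next Obligation.
by move=> X Y Z g a f f'; apply: chain_hom_ext => i; exact: comp_linr.
Qed.

Lemma chainCat_zero : exists Z : chainCat, is_zero Z.
Proof.
have [[Z Z0] _] := pre_additive F.
exists (Chain (fun=> adm_mono_id (exactP F) Z) : chainCat) => X.
by split=> f; apply: chain_hom_ext => i; [exact: (Z0 _).1 | exact: (Z0 _).2].
Qed.

Section ChainBiproduct.
Variables (X Y : chain) (S : forall i, biproduct (X i) (Y i)).

Definition chain_bp_ob : chain := @Chain (fun i => S i)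
  (fun i => bp_map (S (ch_src i)) (S (ch_tgt i)) (ch_map X i) (ch_map Y i))
  (fun i => bp_map_adm_mono _ _ (ch_mono X i) (ch_mono Y i)).

Program Definition chain_bp : @biproduct K chainCat X Y :=
  @Biproduct K chainCat X Y chain_bp_ob
    (@mk_chain_hom X chain_bp_ob (fun i => bp_inl (S i)) _)
    (@mk_chain_hom Y chain_bp_ob (fun i => bp_inr (S i)) _)
    (@mk_chain_hom chain_bp_ob X (fun i => bp_prl (S i)) _)
    (@mk_chain_hom chain_bp_ob Y (fun i => bp_prr (S i)) _) _ _ _ _ _.
Next Obligation. by move=> i; rewrite bp_map_inl. Qed.
Next Obligation. by move=> i; rewrite bp_map_inr. Qed.
Next Obligation. by move=> i; rewrite bp_map_prl. Qed.
Next Obligation. by move=> i; rewrite bp_map_prr. Qed.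
Next Obligation. by apply: chain_hom_ext => i; exact: bp_ll. Qed.
Next Obligation. by apply: chain_hom_ext => i; exact: bp_rr. Qed.
Next Obligation. by apply: chain_hom_ext => i; exact: bp_lr. Qed.
Next Obligation. by apply: chain_hom_ext => i; exact: bp_rl. Qed.
Next Obligation. by apply: chain_hom_ext => i; exact: bp_id. Qed.

End ChainBiproduct.

Fact chainCat_additive : additive_cat chainCat.
Proof.
split=> [|X Y]; first exact: chainCat_zero.
by split; apply: chain_bp => i; exact: (inhabited_witness ((pre_additive F).2 _ _)).
Qed.

(* Mor^m_l(F) with the termwise exact structure. *)
Definition Morm : preExactCat K := @PreExactCat K chainCat chainCat_additive
  (fun X Y Z (f : chain_hom X Y) (g : chain_hom Y Z) =>
     forall i, conflation (f i) (g i)).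

End Chains.

Section Diagram.
Context (K : fieldType) (F : frobeniusCat K) (l : nat).

(* Objects and morphisms are total functions of (i, j); they are constrained,
   and used, only for indices in the range of the triangular diagram:
   objects for i <= j + 1 with i, j <= l and I^j = dg_ob j.+1 j (j < l),
   dg_hor i j for i <= j + 1 <= l, dg_ver i j for i <= j <= l with i < l.
   The isomorphisms dg_eta, with respect to which dg_row0 is stated, are part
   of the data. *)
Record dual_diagram (X : Morm F l) := DualDiagram {
  dg_ob : nat -> nat -> F;
  dg_hor : forall i j, hom (dg_ob i j) (dg_ob i j.+1);
  dg_ver : forall i j, hom (dg_ob i j) (dg_ob i.+1 j);
  dg_inj : forall j, (j < l)%N -> injective_ob (dg_ob j.+1 j);
  dg_ver_mono : forall i j, (i <= j)%N -> (j <= l)%N -> (i < l)%N ->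
    adm_mono (dg_ver i j);
  dg_bicartesian : forall i j, (i <= j)%N -> (j < l)%N ->
    bicartesian (dg_hor i j) (dg_ver i j) (dg_ver i j.+1) (dg_hor i.+1 j);
  dg_eta : forall j : 'I_l.+1,
    @represents K (stable F) (ch_ob X j) (dg_ob 0 j);
  dg_row0 : forall j : 'I_l,
    corresponds (dg_eta (ch_src j)) (dg_eta (ch_tgt j))
      (stable_cl (ch_map X j)) (stable_cl (dg_hor 0 j)) }.

Definition last_column (X : Morm F l) (D : dual_diagram X) : Morm F l :=
  @Chain K F l (fun i => dg_ob D i l) (fun i => dg_ver D i l)
    (fun i => dg_ver_mono D (ltnW (ltn_ord i)) (leqnn l) (ltn_ord i)).

End Diagram.

(* Main.v *)
(* Xt represents the dual of Hom(X, -) exactly when there is a functional t (a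
   trace) on Hom(X, Xt) whose pairings (g, h) |-> t (g h) are perfect. Given
   conflations A -> B -> X and At -> Bt -> Xt in a Frobenius category and
   compatible traces for (A, At) and (B, Bt), a trace for (X, Xt) is an
   extension of the functional forced on the maps X -> Xt that factor through
   Bt -> Xt or through the connecting map X -> S A; its values there agree where
   both are defined, and perfectness is the five lemma done by hand.

   For chains, write X as the last of its truncations
   T_j = (X^0 -> ... -> X^j = X^j = ...), and let C_j be column j of the diagram
   continued by the constant I^j. Put P_m(A) = (0 -> ... -> 0 -> A = A = ...),
   with A from index m on, and Q_m(A) = (A = ... = A -> I = I = ...), with A up
   to index m and A -> I an admissible mono into an injective. There are
   conflations
     P_{j+1}(X^j) -> T_j (+) P_{j+1}(X^{j+1}) -> T_{j+1}
   and, by the bicartesian squares,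
     Q_{j+1}(X~^{0,j}) -> C_j (+) Q_{j+1}(X~^{0,j+1}) -> C_{j+1}.
   Stably, maps out of P_m(A) and maps into Q_m(A) are determined by their
   component at m, so the traces of the first row give those of P and Q, and
   induction on j ends with the last column. *)

From HB Require Import structures.
From mathcomp Require Import all_boot all_algebra zify.
From mathcomp Require Import boolp classical_sets.
Require Import Defs.

Set Implicit Arguments.
Unset Strict Implicit.
Unset Printing Implicit Defensive.

Import GRing.Theory.

Local Open Scope ring_scope.

#[local] Arguments sub_mem : simpl never.

(** * Extension of functionals *)

Section ExtendFunctional.
Context (K : fieldType) (V : lmodType K).
Implicit Type G : V -> K -> Prop.

(** The graph of a functional defined on a subspace. In relational form, partial functionals with
    different domains can be compared in Zorn's lemma. *)
Let linear_graph G := [/\ G 0 0,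
  forall a u x v y, G u x -> G v y -> G (a *: u + v) (a * x + y) &
  forall x, G 0 x -> x = 0].

Let linear_graph_fun G v x y : linear_graph G -> G v x -> G v y -> x = y.
Proof.
move=> [_ lin fn] Gx Gy; apply/eqP; rewrite -subr_eq0; apply/eqP/fn.
by have := lin (-1) _ _ _ _ Gy Gx; rewrite scaleN1r addNr mulN1r addrC.
Qed.

(** The new vector [v] is sent to 0. The result is single-valued: if [m + a *: v] vanishes with [a]
    nonzero, then [v] already lies in the domain. *)
Let extend_graph G v : linear_graph G -> ~ (exists x, G v x) ->
  linear_graph (fun u x => exists a m, G m x /\ u = m + a *: v).
Proof.
move=> [G0 lin fn] nGv; split.
- by exists 0, 0; rewrite scale0r addr0.
- move=> a _ x _ y [b [m [Gm ->]]] [c [n [Gn ->]]].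
  exists (a * b + c), (a *: m + n); split; first exact: lin.
  by rewrite scalerDr scalerDl scalerA addrACA.
move=> x [a [m [Gm /esym /eqP]]]; rewrite addr_eq0 => /eqP mE.
have [a0|a0] := eqVneq a 0.
  by apply: fn; rewrite mE a0 scale0r oppr0 in Gm.
case: nGv; exists (- a^-1 * x + 0).
have -> : v = - a^-1 *: m + 0.
  by rewrite mE addr0 scaleNr scalerN opprK scalerA mulVf// scale1r.
exact: lin.
Qed.

Lemma extend_linear_graph G : linear_graph G ->
  exists s : dual V, forall v x, G v x -> s v = x.
Proof.
move=> Glin.
pose ext H := linear_graph H /\ forall v x, G v x -> H v x.
pose T := {H | ext H}.
pose le (H H' : T) := `[< forall v x, sval H v x -> sval H' v x >].
have [|||A totA|M Mmax] := @Zorn T le.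
- by move=> H; apply/asboolP.
- by move=> H1 H2 H3 /asboolP H12 /asboolP H23; apply/asboolP => v x /H12 /H23.
- move=> [H1 p1] [H2 p2] /asboolP H12 /asboolP H21; apply: eq_exist => /=.
  by apply/funext => v; apply/funext => x; apply/propext; split; [exact: H12|exact: H21].
(* The empty chain is bounded by [G], a nonempty one by the union of its graphs. *)
- have [[H0 AH0]|A0] := pselect (exists H, A H); last first.
    by exists (exist ext G (conj Glin (fun _ _ => id))) => H AH; case: A0; exists H.
  suff Ulin : linear_graph (fun v x => exists H, A H /\ sval H v x) /\
      forall v x, G v x -> exists H, A H /\ sval H v x.
    by exists (exist ext _ Ulin) => H AH; apply/asboolP => v x Hvx /=; exists H.
  split; last by move=> v x Gvx; exists H0; split=> //; exact: (svalP H0).2.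
  split.
  + by exists H0; split=> //; have [[]] := svalP H0.
  + move=> a u x v y [H1 [A1 G1]] [H2 [A2 G2]].
    have [/asboolP H12|/asboolP H21] := totA _ _ A1 A2.
      exists H2; split=> //; have [[_ lin _] _] := svalP H2.
      by apply: lin => //; exact: H12.
    exists H1; split=> //; have [[_ lin _] _] := svalP H1.
    by apply: lin => //; exact: H21.
  + by move=> x [H [_]]; have [[_ _ fn] _] := svalP H; exact: fn.
have [Mlin GM] := (svalP M).
have Mtot v : exists x, sval M v x.
  apply: contrapT => nMv.
  have Elin := extend_graph Mlin nMv.
  have GE u x : G u x -> exists a m, sval M m x /\ u = m + a *: v.
    by move=> Gu; exists 0, u; rewrite scale0r addr0; split=> //; exact: GM.
  pose E : T := exist ext _ (conj Elin GE).
  (* By maximality the extension adds nothing, yet it is defined at [v]. *)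
  have ME : E = M.
    by apply: Mmax; apply/asboolP => u x Mux /=; exists 0, u; rewrite scale0r addr0.
  apply: nMv; exists 0; rewrite -ME; exists 1, 0.
  by rewrite scale1r add0r; split=> //; have [] := Mlin.
have [s sP] := choice Mtot.
have s_lin : linear (s : V -> K^o).
  move=> a u v; apply: (linear_graph_fun Mlin (sP _)).
  by have [_ lin _] := Mlin; exact: lin.
pose sL := GRing.isLinear.Build K V K^o *:%R s s_lin.
pose s' : {linear V -> K^o} := HB.pack (s : V -> K^o) sL.
exists s' => v x Gvx.
exact: (linear_graph_fun Mlin (sP v) (GM _ _ Gvx)).
Qed.

End ExtendFunctional.

(** [R v w] prescribes the value [t w] at [v]. Two choices of [w] for the same [v] differ by an
    element related to 0, so the prescription is consistent. Functionals are thereby defined through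
    lifts or preimages that are not unique, without choosing any. *)
Lemma extend_functional (K : fieldType) (V W : lmodType K) (R : V -> W -> Prop)
    (t : dual W) :
  R 0 0 ->
  (forall a u x v y, R u x -> R v y -> R (a *: u + v) (a *: x + y)) ->
  (forall w, R 0 w -> t w = 0) ->
  exists s : dual V, forall v w, R v w -> s v = t w.
Proof.
move=> R0 Rlin Rt.
have [|s sP] := @extend_linear_graph K V (fun v x => exists w, R v w /\ t w = x).
  split.
  - by exists 0; rewrite linear0.
  - move=> a u _ v _ [w [Rw <-]] [w' [Rw' <-]]; exists (a *: w + w').
    by split; [exact: Rlin | rewrite linearP].
  - by move=> x [w [Rw <-]]; exact: Rt.
by exists s => v w Rvw; apply: sP; exists w.
Qed.

(** * Traces along a conflation *)

Section Submodule.
Context (K : fieldType) (V : lmodType K) (S : submodule V).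

Lemma sub_memN v : S v -> S (- v).
Proof. by rewrite -scaleN1r; exact: sub_memZ. Qed.

End Submodule.


Section Frobenius.
Context (K : fieldType) (E : preExactCat K).
Implicit Types A B D I P X Y : E.

(* The part of the Frobenius axioms from which duality is propagated along
   conflations; pushouts and pullbacks play no role in it. *)
Record frobenius_axioms : Prop := FrobeniusAxioms {
  frob_ker : forall A B D (i : hom A B) (p : hom B D), conflation i p -> is_kernel i p;
  frob_coker : forall A B D (i : hom A B) (p : hom B D), conflation i p -> is_cokernel i p;
  frob_inj : forall A, exists I D (i : hom A I) (p : hom I D),
    injective_ob I /\ conflation i p;
  frob_proj : forall A, exists D P (i : hom D P) (p : hom P A),
    injective_ob P /\ conflation i p;
  frob_inj_proj : forall I, injective_ob I -> projective_ob I }.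

(** A functional on stable morphisms, written on representatives: sending [g] to [t (g \oc _)] is a
    bijection from stable Hom(Y, At) to the dual of stable Hom(A, Y). As no quotient occurs, duality
    can be propagated by diagram chases in [E] itself. *)
Definition dualizes A At (t : dual (hom A At)) :=
  [/\ forall f, inj_ideal A At f -> t f = 0,
      forall Y (g : hom Y At), (forall h, t (g \oc h) = 0) -> inj_ideal Y At g &
      forall Y (xi : dual (hom A Y)), (forall h, inj_ideal A Y h -> xi h = 0) ->
        exists g : hom Y At, forall h, t (g \oc h) = xi h].

Context (FE : frobenius_axioms).

Lemma ideal_inj A B I (g : hom A I) (h : hom I B) :
  injective_ob I -> inj_ideal A B (h \oc g).
Proof. by move=> injI; exists I, g, h. Qed.

Lemma conf0 A B D (i : hom A B) (p : hom B D) : conflation i p -> p \oc i = 0.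
Proof. by case/(frob_ker FE). Qed.

Lemma conf_mono A B D (i : hom A B) (p : hom B D) T (u v : hom T A) :
  conflation i p -> i \oc u = i \oc v -> u = v.
Proof.
move=> ip uv; have [pi univ] := frob_ker FE ip.
have [|w [_ wu]] := univ _ (i \oc u); first by rewrite comp_assoc pi comp0l.
by rewrite -(wu u)// -(wu v)//.
Qed.

Lemma conf_epi A B D (i : hom A B) (p : hom B D) T (u v : hom D T) :
  conflation i p -> u \oc p = v \oc p -> u = v.
Proof.
move=> ip uv; have [pi univ] := frob_coker FE ip.
have [|w [_ wu]] := univ _ (u \oc p); first by rewrite -comp_assoc pi comp0r.
by rewrite -(wu u)// -(wu v)//.
Qed.

Lemma conf_lift A B D (i : hom A B) (p : hom B D) T (f : hom T B) :
  conflation i p -> p \oc f = 0 -> exists g, f = i \oc g.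
Proof. by move=> /(frob_ker FE)[_ univ] /univ[g [<- _]]; exists g. Qed.

Lemma conf_desc A B D (i : hom A B) (p : hom B D) T (f : hom B T) :
  conflation i p -> f \oc i = 0 -> exists g, f = g \oc p.
Proof. by move=> /(frob_coker FE)[_ univ] /univ[g [<- _]]; exists g. Qed.

Lemma inj_extend A B D (i : hom A B) (p : hom B D) I (f : hom A I) :
  conflation i p -> injective_ob I -> exists g, f = g \oc i.
Proof.
by move=> ip injI; have [|g <-] := injI _ _ i _ f; [exists D, p | exists g].
Qed.

Lemma proj_lift A B D (i : hom A B) (p : hom B D) P (f : hom P D) :
  conflation i p -> injective_ob P -> exists g, f = p \oc g.
Proof.
move=> ip /(frob_inj_proj FE) projP.
by have [|g <-] := projP _ _ p _ f; [exists A, i | exists g].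
Qed.

(** Only the first factor is extended, so the result still passes through the same injective
    object. *)
Lemma ideal_extend A B D (i : hom A B) (p : hom B D) Y (f : hom A Y) :
  conflation i p -> inj_ideal A Y f -> exists g, inj_ideal B Y g /\ f = g \oc i.
Proof.
move=> ip [I [u [v [injI ->]]]]; have [u' ->] := inj_extend u ip injI.
by exists (v \oc u'); rewrite comp_assoc; split=> //; exact: ideal_inj.
Qed.

Lemma ideal_lift A B D (i : hom A B) (p : hom B D) Y (f : hom Y D) :
  conflation i p -> inj_ideal Y D f -> exists g, inj_ideal Y B g /\ f = p \oc g.
Proof.
move=> ip [I [u [v [injI ->]]]]; have [v' ->] := proj_lift v ip injI.
by exists (v' \oc u); rewrite comp_assoc; split=> //; exact: ideal_inj.
Qed.

(** * Maps of conflations: the suspension on representatives *)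

Section Ladders.
Variables (A I S : E) (i : hom A I) (p : hom I S).
Variables (A' I' S' : E) (i' : hom A' I') (p' : hom I' S').
Hypotheses (ip : conflation i p) (ip' : conflation i' p').

(** When the middle terms are injective, this says that [m] is stably the suspension of [n]. A
    relation avoids choosing the middle map. *)
Definition lad (n : hom A A') (m : hom S S') :=
  exists w, w \oc i = i' \oc n /\ m \oc p = p' \oc w.

Lemma lad_lin a n m n' m' : lad n m -> lad n' m' -> lad (a *: n + n') (a *: m + m').
Proof.
move=> [w [wi mp]] [w' [wi' mp']]; exists (a *: w + w').
by rewrite !comp_linl !comp_linr wi wi' mp mp'.
Qed.

Lemma lad_left (m : hom S S') : injective_ob I -> exists n, lad n m.
Proof.
move=> injI; have [w mp] := proj_lift (m \oc p) ip' injI.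
have [|n wi] := conf_lift (f := w \oc i) ip'; last by exists n, w.
by rewrite comp_assoc -mp -comp_assoc (conf0 ip) comp0r.
Qed.

Lemma lad_right (n : hom A A') : injective_ob I' -> exists m, lad n m.
Proof.
move=> injI; have [w wi] := inj_extend (i' \oc n) ip injI.
have [|m mp] := conf_desc (f := p' \oc w) ip; last by exists m, w.
by rewrite -comp_assoc -wi comp_assoc (conf0 ip') comp0l.
Qed.

(** A map [m] in the ideal lifts through [p'] to some [m']. The middle map minus [m' \oc p] lands in
    the kernel of [p'], and restricting it along [i] factors [n] through [I]. *)
Lemma lad_ideal_left n m : injective_ob I -> lad n m -> inj_ideal S S' m ->
  inj_ideal A A' n.
Proof.
move=> injI [w [wi mp]] /(ideal_lift ip')[m' [_ mE]].
have [|n' wE] := conf_lift (f := w - m' \oc p) ip'.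
  by rewrite compBr comp_assoc -mE mp subrr.
suff -> : n = n' \oc i by exact: ideal_inj.
apply: (conf_mono ip'); rewrite comp_assoc -wE compBl -comp_assoc (conf0 ip).
by rewrite comp0r subr0.
Qed.

Lemma lad_ideal_right n m : injective_ob I' -> lad n m -> inj_ideal A A' n ->
  inj_ideal S S' m.
Proof.
move=> injI [w [wi mp]] /(ideal_extend ip)[n' [_ nE]].
have [|m' wE] := conf_desc (f := w - i' \oc n') ip.
  by rewrite compBl -comp_assoc -nE wi subrr.
suff -> : m = p' \oc m' by exact: ideal_inj.
apply: (conf_epi ip); rewrite -comp_assoc -wE compBr comp_assoc (conf0 ip').
by rewrite comp0l subr0.
Qed.

End Ladders.

Lemma lad0 A I S (i : hom A I) (p : hom I S) A' I' S' (i' : hom A' I') (p' : hom I' S') :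
  lad i p i' p' 0 0.
Proof. by exists 0; rewrite !comp0l !comp0r. Qed.

Lemma lad_comp A I S (i : hom A I) (p : hom I S) A' I' S' (i' : hom A' I') (p' : hom I' S')
    A2 I2 S2 (i2 : hom A2 I2) (p2 : hom I2 S2) n m n' m' :
  lad i p i' p' n m -> lad i' p' i2 p2 n' m' -> lad i p i2 p2 (n' \oc n) (m' \oc m).
Proof.
move=> [w [wi mp]] [w' [wi' mp']]; exists (w' \oc w).
rewrite -comp_assoc wi !comp_assoc wi'; split=> //.
by rewrite -comp_assoc mp comp_assoc mp' -comp_assoc.
Qed.

(** The trace is carried to the suspensions along ladders; this is well defined because a ladder
    with right end 0 has its left end in the ideal. Perfectness at [Y] reduces to perfectness of [t]
    at the loop object [O] of [Y]. *)
Lemma dualizes_shift A I S (i : hom A I) (p : hom I S)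
    At It St (it : hom At It) (pt : hom It St) (t : dual (hom A At)) :
  conflation i p -> conflation it pt -> injective_ob I -> injective_ob It ->
  dualizes t ->
  exists s : dual (hom S St), dualizes s /\ forall n m, lad i p it pt n m -> s m = t n.
Proof.
move=> ip ipt injI injIt [t0 t_inj t_surj].
have [|a m n m' n'|n|s sP] :=
    extend_functional (R := fun m n => lad i p it pt n m) (t := t).
- exact: lad0.
- exact: lad_lin.
- by move/(lad_ideal_left ip ipt injI) => nI; apply: t0; apply: nI; exact: sub_mem0.
exists s; split=> [|n m]; last exact: sP.
split.
- move=> m mI; have [n nm] := lad_left ip ipt m injI.
  by rewrite (sP _ _ nm); apply: t0; exact: lad_ideal_left nm mI.
- move=> Y g sg; have [O [P [j [q [injP jq]]]]] := frob_proj FE Y.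
  have [g0 gg] := lad_left jq ipt g injP.
  apply: (lad_ideal_right jq ipt injIt gg); apply: t_inj => h0.
  have [h hh] := lad_right ip jq h0 injP.
  by rewrite -(sP _ _ (lad_comp hh gg)).
- move=> Y xi xi0; have [O [P [j [q [injP jq]]]]] := frob_proj FE Y.
  have [|a h0 h h0' h'|h|xi' xiP] :=
      extend_functional (R := fun h0 h => lad i p j q h0 h) (t := xi).
  + exact: lad0.
  + exact: lad_lin.
  + by move/(lad_ideal_right ip jq injP) => hI; apply: xi0; apply: hI; exact: sub_mem0.
  have [h0 h0I|g0 g0P] := t_surj _ xi'.
    have [h hh] := lad_right ip jq h0 injP.
    by rewrite (xiP _ _ hh); apply: xi0; exact: lad_ideal_right hh h0I.
  have [g gg] := lad_right jq ipt g0 injIt.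
  exists g => h; have [h0 hh] := lad_left ip jq h injI.
  by rewrite (sP _ _ (lad_comp hh gg)) g0P (xiP _ _ hh).
Qed.

(** * Duality for the third terms of two conflations *)

Section Cone.
Variables (A B X : E) (f : hom A B) (p : hom B X).
Variables (At Bt Xt : E) (ft : hom At Bt) (pt : hom Bt Xt).
Hypotheses (fp : conflation f p) (fpt : conflation ft pt).
Variables (tA : dual (hom A At)) (tB : dual (hom B Bt)).
Hypotheses (dA : dualizes tA) (dB : dualizes tB).
Hypothesis tAB : forall k : hom B At, tB (ft \oc k) = tA (k \oc f).

(** The suspension [S] of [A] and the connecting maps [d : X -> S], [dt : Xt -> St] continue the two
    conflations by one step. The minus sign in [t'] is what makes the two prescriptions for [tX]
    compatible. *)
Lemma dualizes_cone :
  exists tX : dual (hom X Xt), dualizes tX /\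
    forall k : hom X Bt, tX (pt \oc k) = tB (k \oc p).
Proof.
have [I [S [a [q [injI aq]]]]] := frob_inj FE A.
have [It [St [at' [qt [injIt aqt]]]]] := frob_inj FE At.
have [tS [dS tSA]] := dualizes_shift aq aqt injI injIt dA.
have [tA0 tA_inj tA_surj] := dA; have [tB0 tB_inj tB_surj] := dB.
have [tS0 tS_inj tS_surj] := dS.
have [a' a'E] := inj_extend a fp injI.
have [|d dE] := conf_desc (f := q \oc a') fp.
  by rewrite -comp_assoc -a'E (conf0 aq).
have [at1 at1E] := inj_extend at' fpt injIt.
have [|dt dtE] := conf_desc (f := qt \oc at1) fpt.
  by rewrite -comp_assoc -at1E (conf0 aqt).
pose R (phi : hom X Xt) (km : hom X Bt * hom S Xt) :=
  inj_ideal X Xt (phi - (pt \oc km.1 + km.2 \oc d)).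
pose t' (km : hom X Bt * hom S Xt) : K^o := tB (km.1 \oc p) - tS (dt \oc km.2).
have t'_lin : linear t'.
  move=> x [k m] [k' m']; rewrite /t' /= comp_linl comp_linr !linearP /=.
  by rewrite addrACA -scalerDr.
pose tL := GRing.isLinear.Build K _ K^o *:%R t' t'_lin.
pose t : dual (hom X Bt * hom S Xt)%type := HB.pack t' tL.
(* Agreement on overlaps: up to a map through [I], [k \oc p] is [ft \oc z], with trace
   [tA (z \oc f)]; and [z \oc f], [dt \oc m] are the ends of a ladder with middle map
   [at1 \oc y]. *)
have Rstrict k m : pt \oc k + m \oc d = 0 -> tB (k \oc p) = tS (dt \oc m).
  move=> /eqP; rewrite addr_eq0 => /eqP km.
  have [y yE] := proj_lift (m \oc q) fpt injI.
  have [|z zE] := conf_lift (f := k \oc p + y \oc a') fpt.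
    by rewrite compDr !comp_assoc -yE km compNl -!comp_assoc dE addNr.
  have zfE : ft \oc (z \oc f) = y \oc a.
    rewrite comp_assoc -zE compDl -comp_assoc (conf0 fp) comp0r add0r.
    by rewrite -comp_assoc -a'E.
  have -> : k \oc p = ft \oc z - y \oc a' by rewrite -zE addrK.
  rewrite linearB /= (tB0 (y \oc a')) ?subr0; last exact: ideal_inj.
  rewrite tAB; apply/esym/tSA; exists (at1 \oc y); split.
    by rewrite -comp_assoc -zfE comp_assoc -at1E.
  by rewrite -comp_assoc yE !comp_assoc dtE.
have [|x u km v km' Ru Rv|[k m]|tX tXP] := extend_functional (R := R) (t := t).
- by rewrite /R /= comp0r comp0l addr0 subr0; exact: sub_mem0.
- rewrite /R /= comp_linl comp_linr.
  have -> : x *: u + v - (x *: (pt \oc km.1) + pt \oc km'.1 +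
      (x *: (km.2 \oc d) + km'.2 \oc d)) =
      x *: (u - (pt \oc km.1 + km.2 \oc d)) + (v - (pt \oc km'.1 + km'.2 \oc d)).
    by rewrite [in LHS]addrACA -scalerDr opprD addrACA scalerBr.
  by apply: sub_memD => //; exact: sub_memZ.
(* If [pt \oc k + m \oc d] is merely in the ideal, subtracting from [k] a suitable [k'] in the ideal
   makes it zero. *)
- rewrite /R sub0r /= => /sub_memN; rewrite opprK => /(ideal_lift fpt)[k' [k'I kE]].
  rewrite /t /= /t'; apply/eqP; rewrite subr_eq0 /=; apply/eqP.
  rewrite -(Rstrict (k - k')); last by rewrite compBr -kE opprD addrA subrr sub0r addNr.
  by rewrite compBl linearB /= (tB0 (k' \oc p)) ?subr0//; exact: inj_ideal_compr.
have tX0 phi : inj_ideal X Xt phi -> tX phi = 0.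
  move=> phiI; rewrite (tXP phi 0) ?linear0 // /R /=.
  by rewrite comp0r comp0l addr0 subr0.
have tXp k : tX (pt \oc k) = tB (k \oc p).
  rewrite (tXP _ (k, 0)) /R /=; last by rewrite comp0l addr0 subrr; exact: sub_mem0.
  by rewrite /t' /= comp0r linear0 subr0.
have tXd m : tX (m \oc d) = - tS (dt \oc m).
  rewrite (tXP _ (0, m)) /R /=; last by rewrite comp0r add0r subrr; exact: sub_mem0.
  by rewrite /t' /= comp0l linear0 sub0r.
exists tX; split=> //; split=> // Y.
- move=> g gP; have [O [P [j [r [injP jr]]]]] := frob_proj FE Y.
  (* Exactness at [Xt]: [dt \oc g] is in the ideal, so it lifts to [u : Y -> It]. A lift [e'] of [g]
     and [u] to [Bt] is found on the cover [P] and descends to [Y] because it kills [O]. *)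
  have [b gE] : exists b, g = pt \oc b.
    have [|u [_ uE]] := ideal_lift (f := dt \oc g) aqt.
      by apply: tS_inj => h; rewrite -comp_assoc -[LHS]opprK -tXd -comp_assoc gP oppr0.
    have [e eE] := proj_lift (g \oc r) fpt injP.
    have [|n nE] := conf_lift (f := at1 \oc e - u \oc r) aqt.
      rewrite compBr !comp_assoc dtE -uE -!comp_assoc eE.
      by rewrite subrr.
    pose e' := e - ft \oc n.
    have e'1 : pt \oc e' = g \oc r.
      by rewrite compBr comp_assoc (conf0 fpt) comp0l subr0 eE.
    have e'2 : at1 \oc e' = u \oc r.
      by rewrite compBr comp_assoc -at1E -nE subKr.
    have [|c cE] := conf_lift (f := e' \oc j) fpt.
      by rewrite comp_assoc e'1 -comp_assoc (conf0 jr) comp0r.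
    have c0 : c = 0.
      apply: (conf_mono aqt); rewrite comp0r at1E -comp_assoc -cE comp_assoc e'2.
      by rewrite -comp_assoc (conf0 jr) comp0r.
    have [|b bE] := conf_desc (f := e') jr; first by rewrite cE c0 comp0r.
    by exists b; apply: (conf_epi jr); rewrite -e'1 bE comp_assoc.
  have bP k : tB (b \oc k \oc p) = 0 by rewrite -tXp comp_assoc -gE.
  (* [tb] kills all [k \oc p], hence is induced by a functional [xi] on Hom(A, Y). If [c] represents
     [xi], then [b - ft \oc c] is in the ideal, and it has the same image [g] under [pt]. *)
  pose tb : dual (hom B Y) := transpose (postcomp b) tB.
  have tb0 h : inj_ideal B Y h -> tb h = 0.
    by move=> hI; apply: tB0; exact: inj_ideal_compl.
  have [|x u h v h' Ru Rv|h|xi xiP] := extend_functional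
      (R := fun (e : hom A Y) (h : hom B Y) => inj_ideal A Y (e - h \oc f)) (t := tb).
  + by rewrite comp0l subr0; exact: sub_mem0.
  + rewrite comp_linl opprD addrACA -scalerBr.
    by apply: sub_memD => //; exact: sub_memZ.
  + rewrite sub0r => /sub_memN; rewrite opprK => /(ideal_extend fp)[h' [h'I hE]].
    have [|k kE] := conf_desc (f := h - h') fp; first by rewrite compBl hE subrr.
    have -> : h = k \oc p + h' by rewrite -kE subrK.
    by rewrite linearD (tb0 h')// addr0 /tb /= /postcomp comp_assoc bP.
  have [e eI|c cP] := tA_surj _ xi.
    by rewrite (xiP _ 0) ?linear0// comp0l subr0.
  have bc : inj_ideal _ _ (b - ft \oc c).
    apply: tB_inj => h; rewrite compBl linearB /= -comp_assoc tAB -comp_assoc cP.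
    by rewrite (xiP _ h) ?subrr//; exact: sub_mem0.
  have -> : g = pt \oc (b - ft \oc c).
    by rewrite compBr comp_assoc (conf0 fpt) comp0l subr0.
  exact: inj_ideal_compl.
- move=> xi xi0.
  (* Functionals killing all [h \oc d] suffice: some [g1] cancels the values of [xi] on these
     maps. *)
  suff base (xi' : dual (hom X Y)) : (forall h, inj_ideal X Y h -> xi' h = 0) ->
      (forall h, xi' (h \oc d) = 0) ->
      exists g : hom Y Xt, forall h, tX (g \oc h) = xi' h.
    have [O [P [j [r [injP jr]]]]] := frob_proj FE Y.
    have [h hI|s sP] := tS_surj Y (transpose (precomp d) xi).
      by apply: xi0; exact: inj_ideal_compr.
    have {}sP h : tS (s \oc h) = xi (h \oc d) by exact: sP.
    (* [s] represents [xi] on the maps [h \oc d]. It comes, up to the ideal, from a map into [Xt] as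
       soon as its desuspension [s0] becomes stably zero after [ft]. *)
    have [s0 [v [vj sr]]] := lad_left jr aqt s injP.
    have /(ideal_extend jr)[e [_ eE]] : inj_ideal O Bt (ft \oc s0).
      apply: tB_inj => h0; rewrite -comp_assoc tAB -comp_assoc.
      have [m [y [ya mq]]] := lad_right aq jr (h0 \oc f) injP.
      have -> : tA (s0 \oc (h0 \oc f)) = tS (s \oc m).
        by apply/esym/tSA; apply: (lad_comp (i' := j) (p' := r)); [exists y | exists v].
      rewrite sP; apply: xi0.
      have [|z zE] := conf_desc (f := y \oc a' - j \oc h0) fp.
        by rewrite compBl -!comp_assoc -a'E ya subrr.
      have -> : m \oc d = r \oc z.
        apply: (conf_epi fp); rewrite -!comp_assoc -zE -dE compBr.
        by rewrite !comp_assoc (conf0 jr) comp0l subr0 mq.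
      exact: ideal_inj.
    have [|g1 g1E] := conf_desc (f := pt \oc e) jr.
      by rewrite -comp_assoc -eE comp_assoc (conf0 fpt) comp0l.
    have [|z zE] := conf_desc (f := at1 \oc e - v) jr.
      by rewrite compBl -comp_assoc -eE vj comp_assoc -at1E subrr.
    have g1s : dt \oc g1 = s + qt \oc z.
      apply: (conf_epi jr); rewrite compDl -!comp_assoc -g1E -zE sr compBr.
      by rewrite !comp_assoc dtE [RHS]addrC subrK.
    have xid h : tX (g1 \oc (h \oc d)) = - xi (h \oc d).
      rewrite comp_assoc tXd comp_assoc g1s compDl linearD /= sP.
      by rewrite (tS0 (qt \oc z \oc h)) ?addr0// -comp_assoc; exact: ideal_inj.
    pose xi' : dual (hom X Y) := xi + transpose (postcomp g1) tX.
    have xi'E h : xi' h = xi h + tX (g1 \oc h) by [].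
    have [h hI|h|g2 g2P] := base xi'.
    + by rewrite xi'E (xi0 _ hI) add0r; apply: tX0; exact: inj_ideal_compl.
    + by rewrite xi'E xid subrr.
    by exists (g2 - g1) => h; rewrite compBl linearB g2P xi'E; exact: addrK.
  move=> xi'0 xi'd.
  (* [xi'] is transferred to the maps [k \oc p] out of [B]. This is consistent since a [k] with
     [k \oc p] in the ideal is, modulo the ideal, of the form [h \oc d]. *)
  have [|x u k v k' Ru Rv|k|xB xBP] := extend_functional
      (R := fun (b : hom B Y) (k : hom X Y) => inj_ideal B Y (b - k \oc p)) (t := xi').
  + by rewrite comp0l subr0; exact: sub_mem0.
  + rewrite comp_linl opprD addrACA -scalerBr.
    by apply: sub_memD => //; exact: sub_memZ.
  + rewrite sub0r => /sub_memN; rewrite opprK => -[J [u [w [injJ kpE]]]].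
    have [u1 u1E] := inj_extend (u \oc f) aq injJ.
    have [|z zE] := conf_desc (f := u - u1 \oc a') fp.
      by rewrite compBl u1E -comp_assoc -a'E subrr.
    have kwz : (k - w \oc z) \oc p = w \oc u1 \oc a'.
      by rewrite compBl kpE -comp_assoc -zE compBr subKr comp_assoc.
    have [|h hE] := conf_desc (f := w \oc u1) aq.
      by rewrite a'E comp_assoc -kwz -comp_assoc (conf0 fp) comp0r.
    have kE : k = h \oc d + w \oc z.
      apply/eqP; rewrite -subr_eq; apply/eqP; apply: (conf_epi fp).
      by rewrite kwz hE -!comp_assoc dE.
    by rewrite kE linearD /= xi'd add0r; apply: xi'0; exact: ideal_inj.
  have [b bI|b bP] := tB_surj _ xB.
    by rewrite (xBP _ 0) ?linear0// comp0l subr0.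
  exists (pt \oc b) => k; rewrite -comp_assoc tXp -comp_assoc bP.
  by apply: xBP; rewrite subrr; exact: sub_mem0.
Qed.

End Cone.

End Frobenius.

(** * Traces and representations *)

Section Representation.
Context (K : fieldType) (E : preExactCat K).
Implicit Types A B Y : E.

Lemma dualizes_biproduct A B At Bt (S : biproduct A B) (St : biproduct At Bt)
    (tA : dual (hom A At)) (tB : dual (hom B Bt)) :
  dualizes tA -> dualizes tB ->
  exists t : dual (hom S St), dualizes t /\
    forall k, t k = tA (bp_prl St \oc k \oc bp_inl S) + tB (bp_prr St \oc k \oc bp_inr S).
Proof.
move=> [tA0 tA_inj tA_surj] [tB0 tB_inj tB_surj].
pose t : dual (hom S St) :=
  transpose (postcomp (bp_prl St)) (transpose (precomp (bp_inl S)) tA) +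
  transpose (postcomp (bp_prr St)) (transpose (precomp (bp_inr S)) tB).
have tE k : t k = tA (bp_prl St \oc k \oc bp_inl S) + tB (bp_prr St \oc k \oc bp_inr S).
  by [].
exists t; split=> //; split.
- move=> k kI; rewrite tE tA0 ?tB0 ?addr0//;
  by apply: inj_ideal_compr; exact: inj_ideal_compl.
- move=> Y g gP.
  have -> : g = bp_inl St \oc (bp_prl St \oc g) + bp_inr St \oc (bp_prr St \oc g).
    by rewrite !comp_assoc -compDl bp_id comp_idl.
  apply: sub_memD; apply: inj_ideal_compl.
    apply: tA_inj => h; have := gP (h \oc bp_prl S); rewrite tE.
    by rewrite -!comp_assoc bp_ll bp_lr !comp0r linear0 addr0 comp_idr.
  apply: tB_inj => h; have := gP (h \oc bp_prr S); rewrite tE.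
  by rewrite -!comp_assoc bp_rr bp_rl !comp0r linear0 add0r comp_idr.
- move=> Y xi xi0.
  have [h hI|gA gAP] := tA_surj Y (transpose (precomp (bp_prl S)) xi).
    by apply: xi0; exact: inj_ideal_compr.
  have [h hI|gB gBP] := tB_surj Y (transpose (precomp (bp_prr S)) xi).
    by apply: xi0; exact: inj_ideal_compr.
  have {}gAP h : tA (gA \oc h) = xi (h \oc bp_prl S) by exact: gAP.
  have {}gBP h : tB (gB \oc h) = xi (h \oc bp_prr S) by exact: gBP.
  exists (bp_inl St \oc gA + bp_inr St \oc gB) => h; rewrite tE.
  have -> : bp_prl St \oc ((bp_inl St \oc gA + bp_inr St \oc gB) \oc h) = gA \oc h.
    by rewrite comp_assoc compDr !comp_assoc bp_ll bp_lr comp0l comp_idl addr0.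
  have -> : bp_prr St \oc ((bp_inl St \oc gA + bp_inr St \oc gB) \oc h) = gB \oc h.
    by rewrite comp_assoc compDr !comp_assoc bp_rl bp_rr comp0l comp_idl add0r.
  rewrite -!comp_assoc gAP gBP -linearD -!comp_assoc -compDr bp_id comp_idr.
  by [].
Qed.

Lemma stable_cl0 A B (f : hom A B) : stable_cl f = 0 <-> inj_ideal A B f.
Proof.
rewrite -[0]/(stable_cl 0) /stable_cl quot_piE subr0.
by [].
Qed.

End Representation.

Section Trace.
Context (K : fieldType) (C : linCat K).
Implicit Types A Y : C.

(** Yoneda's lemma: [s] is the image of the identity of [At] and determines the whole
    transformation. *)
Lemma trace_represents A At (s : dual (hom A At)) :
  (forall Y (g : hom Y At), (forall h, s (g \oc h) = 0) -> g = 0) ->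
  (forall Y (xi : dual (hom A Y)), exists g : hom Y At, forall h, s (g \oc h) = xi h) ->
  inhabited (represents A At).
Proof.
move=> s_inj s_surj.
pose eta Y (g : hom Y At) : dual (hom A Y) := transpose (postcomp g) s.
have eta_lin Y : linear (eta Y).
  move=> a g g'; apply: dual_ext => h.
  have sE : s ((a *: g + g') \oc h) = a *: s (g \oc h) + s (g' \oc h).
    by rewrite comp_linl linearP.
  exact: sE.
pose etaL Y := GRing.isLinear.Build K (hom_to At Y) (dual_hom A Y) *:%R (eta Y) (eta_lin Y).
pose etaM Y : {linear hom_to At Y -> dual_hom A Y} := HB.pack (eta Y) (etaL Y).
split; exists etaM => [Y|Y Y' f g].
  have [eta' eta'P] := choice (s_surj Y); exists eta' => [g|xi].
    apply/eqP; rewrite -subr_eq0; apply/eqP/s_inj => h.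
    by rewrite compBl linearB /= eta'P subrr.
  by apply: dual_ext; exact: eta'P.
apply: dual_ext => h; have sE : s (g \oc f \oc h) = s (g \oc (f \oc h)).
  by rewrite comp_assoc.
exact: sE.
Qed.

Lemma represents_trace A At (eta : represents A At) Y (g : hom Y At) (h : hom A Y) :
  eta Y g h = eta At (idm At) (g \oc h).
Proof.
have := nat_natural eta g (idm At); rewrite [psh_map _ _ _]comp_idl => ->.
by [].
Qed.

Lemma represents_inj A At (eta : represents A At) Y (g : hom Y At) :
  (forall h, eta At (idm At) (g \oc h) = 0) -> g = 0.
Proof.
move=> gP; apply: (bij_inj (nat_bij eta Y)); rewrite linear0.
by apply: dual_ext => h; rewrite represents_trace gP.
Qed.

Lemma represents_surj A At (eta : represents A At) Y (xi : dual (hom A Y)) :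
  exists g, eta Y g = xi.
Proof. by have [eta' _ eta'K] := nat_bij eta Y; exists (eta' xi). Qed.

(** [ft] is the element of Hom(At, Bt) representing the image of the identity of [At]; naturality
    spreads the equation to all [Y]. *)
Lemma corresponds_ex A B At Bt (etaA : represents A At) (etaB : represents B Bt)
    (f : hom A B) : exists ft, corresponds etaA etaB f ft.
Proof.
have [ft ftP] := represents_surj etaB (dual_hom_map f At (etaA At (idm At))).
exists ft => Y g; apply: dual_ext => h.
rewrite represents_trace -comp_assoc -represents_trace ftP /=.
by rewrite [RHS]represents_trace comp_assoc.
Qed.

End Trace.

Section StableTrace.
Context (K : fieldType) (E : preExactCat K).
Implicit Types A B Y : E.

(** Since [t] kills the ideal, it descends to stable morphisms, where it is a trace in the sense of
    [trace_represents]. *)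
Lemma dualizes_represents A At (t : dual (hom A At)) :
  dualizes t -> inhabited (@represents K (stable E) A At).
Proof.
move=> [t0 t_inj t_surj].
have [|a f x g y|x x0|s sP] := extend_functional
    (R := fun (x : stable_hom A At) (f : hom A At) => x = stable_cl f) (t := t).
- by apply/esym/stable_cl0; exact: sub_mem0.
- by move=> -> ->; exact: stable_clD.
- by apply: t0; apply/stable_cl0.
have {}sP f : s (stable_cl f) = t f by exact: sP.
apply: (@trace_represents _ (stable E) A At s) => [Y g gP|Y xi].
  have [g0 gE] := stable_clP g; rewrite gE; apply/stable_cl0/t_inj => h.
  by rewrite -sP -stable_compE -gE; exact: gP.
have [h /stable_cl0 hI|g gP] := t_surj Y (xi \o @quot_pi _ _ (inj_ideal A Y)).
  have /= -> := congr1 xi hI; exact: linear0.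
exists (stable_cl g) => h; have [h0 ->] := stable_clP h.
transitivity (s (stable_cl (g \oc h0))); first by rewrite -stable_compE.
by rewrite sP gP.
Qed.

Definition stable_trace A At (eta : @represents K (stable E) A At) : dual (hom A At) :=
  eta At (@idm _ (stable E) At) \o @quot_pi _ _ (inj_ideal A At).

Lemma represents_dualizes A At (eta : @represents K (stable E) A At) :
  dualizes (stable_trace eta).
Proof.
split=> [f /stable_cl0 fI|Y g gP|Y xi xi0].
- have /= -> := congr1 (eta At (@idm _ (stable E) At)) fI; exact: linear0.
- apply/stable_cl0/(represents_inj (eta := eta)) => h.
  have [h0 ->] := stable_clP h; rewrite [_ \oc _]stable_compE; exact: gP.
have [|a f x g y|x x0|xi' xi'P] := extend_functional
    (R := fun (x : stable_hom A Y) (f : hom A Y) => x = stable_cl f) (t := xi).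
- by apply/esym/stable_cl0; exact: sub_mem0.
- by move=> -> ->; exact: stable_clD.
- by apply: xi0; apply/stable_cl0.
have [g gP] := represents_surj eta xi'; have [g0 gE] := stable_clP g.
exists g0 => h; rewrite -(xi'P (stable_cl h))// -gP represents_trace gE.
by rewrite [X in eta _ _ X]stable_compE.
Qed.

(** Evaluating the correspondence at the identity of [At], and then at [k], turns it into the
    adjointness that [dualizes_cone] takes as hypothesis. *)
Lemma corresponds_trace (A B At Bt : E) (etaA : @represents K (stable E) A At)
    (etaB : @represents K (stable E) B Bt) (f : hom A B) (ft : hom At Bt) (k : hom B At) :
  @corresponds _ (stable E) _ _ _ _ etaA etaB (stable_cl f) (stable_cl ft) ->
  stable_trace etaB (ft \oc k) = stable_trace etaA (k \oc f).
Proof.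
move=> corr.
have eB := @represents_trace _ (stable E) B Bt etaB At (stable_cl ft) (stable_cl k).
have eA : etaB At (stable_cl ft) (stable_cl k) =
    etaA At (@idm _ (stable E) At) (stable_comp (stable_cl k) (stable_cl f)).
  by have := corr At (@idm _ (stable E) At); rewrite comp_idr => ->.
transitivity (etaB Bt (@idm _ (stable E) Bt) (stable_comp (stable_cl ft) (stable_cl k))).
  by rewrite stable_compE.
by rewrite [LHS](esym eB) eA stable_compE.
Qed.

End StableTrace.

(** * Exact categories *)

Section Squares.
Context (K : fieldType) (C : linCat K).
Implicit Types A B : C.

Lemma pushout_paste A B A' B' A2 B2 (h : hom A B) (v : hom A A') (w : hom B B')
    (h' : hom A' B') (v' : hom A' A2) (w' : hom B' B2) (h2 : hom A2 B2) :
  is_pushout h v w h' -> is_pushout h' v' w' h2 ->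
  is_pushout h (v' \oc v) (w' \oc w) h2.
Proof.
move=> [sq univ] [sq' univ']; split.
  by rewrite -comp_assoc sq !comp_assoc sq'.
move=> T b a2; rewrite comp_assoc => bh.
have [g [[gw gh'] gU]] := univ _ _ _ bh.
have [g2 [[g2w g2h] g2U]] := univ' _ _ _ gh'.
exists g2; split; first by rewrite comp_assoc g2w.
move=> g3 [g3w g3h]; apply: g2U; split=> //.
by apply/esym/gU; split; [rewrite -comp_assoc | rewrite -comp_assoc sq' comp_assoc g3h].
Qed.

Lemma pushout_idh A B (v : hom A B) : is_pushout (idm A) v v (idm B).
Proof.
split=> [|T b a']; first by rewrite comp_idl comp_idr.
rewrite comp_idr => ->; exists a'; split=> [|g [_ <-]]; first by rewrite comp_idr.
by rewrite comp_idr.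
Qed.

Lemma pushout_idv A B (h : hom A B) : is_pushout h (idm A) (idm B) h.
Proof.
split=> [|T b a']; first by rewrite comp_idl comp_idr.
rewrite comp_idr => <-; exists b; split=> [|g [<- _]]; first by rewrite comp_idr.
by rewrite comp_idr.
Qed.

Lemma cokernel_iso A B D D' (i : hom A B) (p : hom B D) (p' : hom B D') :
  is_cokernel i p -> is_cokernel i p' -> exists u, is_iso u /\ u \oc p = p'.
Proof.
move=> [pi univ] [p'i univ'].
have [u [up uU]] := univ _ _ p'i; have [u' [u'p' u'U]] := univ' _ _ pi.
exists u; split=> //; exists u'; split.
  have [w [_ wU]] := univ _ _ pi.
  by rewrite -(wU (idm D)) ?comp_idl//; apply/esym/wU; rewrite -comp_assoc up.
have [w [_ wU]] := univ' _ _ p'i.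
by rewrite -(wU (idm D')) ?comp_idl//; apply/esym/wU; rewrite -comp_assoc u'p'.
Qed.

Lemma kernel_iso A A' B D (i : hom A B) (i' : hom A' B) (p : hom B D) :
  is_kernel i p -> is_kernel i' p -> exists u, is_iso u /\ i' \oc u = i.
Proof.
move=> [pi univ] [pi' univ'].
have [u [up uU]] := univ' _ _ pi; have [u' [u'p' u'U]] := univ _ _ pi'.
exists u; split=> //; exists u'; split.
  have [w [_ wU]] := univ _ _ pi.
  by rewrite -(wU (idm A)) ?comp_idr//; apply/esym/wU; rewrite comp_assoc u'p'.
have [w [_ wU]] := univ' _ _ pi'.
by rewrite -(wU (idm A')) ?comp_idr//; apply/esym/wU; rewrite comp_assoc up.
Qed.

Lemma bp_inl_pushout A B Z (S : biproduct A B) (z : hom Z B) :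
  is_zero Z -> is_pushout (0 : hom Z A) z (bp_inl S) (bp_inr S).
Proof.
move=> Z0; split=> [|T a b _]; first by rewrite [LHS](Z0 _).1 [RHS](Z0 _).1.
exists (a \oc bp_prl S + b \oc bp_prr S); split.
  by rewrite !compDl -!comp_assoc bp_ll bp_lr bp_rl bp_rr !comp0r !comp_idr addr0 add0r.
by move=> g [<- <-]; rewrite -!comp_assoc -compDr bp_id comp_idr.
Qed.

Lemma bp_prl_pullback A B Z (S : biproduct A B) (z : hom A Z) :
  is_zero Z -> is_pullback (bp_prl S) (bp_prr S) z (0 : hom B Z).
Proof.
move=> Z0; split=> [|T a b _]; first by rewrite [LHS](Z0 _).2 [RHS](Z0 _).2.
exists (bp_inl S \oc a + bp_inr S \oc b); split.
  by rewrite !compDr !comp_assoc bp_ll bp_lr bp_rl bp_rr !comp0l !comp_idl addr0 add0r.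
by move=> g [<- <-]; rewrite !comp_assoc -compDl bp_id comp_idl.
Qed.

Lemma bp_shear_iso A B (S : biproduct A B) (x : hom A B) :
  is_iso (idm S + bp_inr S \oc x \oc bp_prl S).
Proof.
set n := bp_inr S \oc x \oc bp_prl S.
have nn : n \oc n = 0.
  by rewrite /n -!comp_assoc (comp_assoc (bp_prl S)) bp_lr comp0l !comp0r.
exists (idm S - n); split.
  by rewrite compBl !compDr !comp_idl !comp_idr nn addr0 addrK.
by rewrite compDl !compBr !comp_idl !comp_idr nn subr0 subrK.
Qed.

End Squares.

Section Exact.
Context (K : fieldType) (F : exactCat K).
Implicit Types A B D X Y : F.
Let ax := exactP F.

Lemma bp_map_id_pullback A B A' (S : biproduct A A') (T : biproduct B A') (p : hom A B) :
  is_pullback (bp_prl S) (bp_map S T p (idm A')) p (bp_prl T).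
Proof.
split=> [|D a b ab]; first by rewrite bp_map_prl.
have bE : bp_prr T \oc bp_map S T p (idm A') = bp_prr S by rewrite bp_map_prr comp_idl.
exists (bp_inl S \oc a + bp_inr S \oc (bp_prr T \oc b)); split.
  split.
    by rewrite compDr !comp_assoc bp_ll bp_lr !comp0l addr0 comp_idl.
  rewrite compDr !comp_assoc bp_map_inl bp_map_inr comp_idr -!comp_assoc ab !comp_assoc.
  by rewrite -compDl bp_id comp_idl.
by move=> g [<- <-]; rewrite !comp_assoc -(comp_assoc _ _ (bp_map _ _ _ _)) bE -compDl
  bp_id comp_idl.
Qed.

Lemma adm_mono_coker A B D (i : hom A B) (p : hom B D) :
  adm_mono i -> is_cokernel i p -> conflation i p.
Proof.
move=> [D0 [p0 ip0]] cp.
have [u [uiso up]] := cokernel_iso (conflation_coker ax ip0) cp.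
by apply: (conflation_iso ax (is_iso_id A) (is_iso_id B) uiso _ _ ip0);
  rewrite ?comp_idl ?comp_idr.
Qed.

Lemma adm_epi_ker A B D (i : hom A B) (p : hom B D) :
  adm_epi p -> is_kernel i p -> conflation i p.
Proof.
move=> [A0 [i0 ip0]] kp.
have [u [uiso ui]] := kernel_iso (conflation_ker ax ip0) kp.
by apply: (conflation_iso ax uiso (is_iso_id B) (is_iso_id D) _ _ ip0);
  rewrite ?comp_idl ?comp_idr.
Qed.

Lemma adm_epi_iso A B B' (p : hom B A) (b : hom B' B) :
  is_iso b -> adm_epi p -> adm_epi (p \oc b).
Proof.
move=> [b' [b'b bb']] [D [i ip]]; exists D, (b' \oc i).
have b'P : is_iso b' by exists b.
apply: (conflation_iso ax (is_iso_id D) b'P (is_iso_id A) _ _ ip).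
  by rewrite comp_idr.
by rewrite comp_idl -comp_assoc bb' comp_idr.
Qed.

Lemma pullback_adm_epi A B A' B' (f : hom A B) (p : hom A A') (p' : hom B B')
    (f' : hom A' B') : is_pullback f p p' f' -> adm_epi p' -> adm_epi p.
Proof.
move=> [sq univ] ep.
have [P [j [g [[sqP univP] ej]]]] := adm_epi_pullback ax f' ep.
have [u [[ug uj] _]] := univP _ _ _ sq.
have [v [[vf vp] _]] := univ _ _ _ sqP.
suff uP : is_iso u by rewrite -uj; exact: adm_epi_iso.
exists v; split.
  have [w [_ wu]] := univ _ _ _ sq.
  by rewrite -(wu (idm A)) ?comp_idr//; apply/esym/wu; rewrite !comp_assoc vf vp.
have [w [_ wu]] := univP _ _ _ sqP.
by rewrite -(wu (idm P)) ?comp_idr//; apply/esym/wu; rewrite !comp_assoc uj ug.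
Qed.

Lemma zero_adm_mono Z A (z : hom Z A) : is_zero Z -> adm_mono z.
Proof.
move=> Z0; exists A, (idm A); apply: (adm_epi_ker (adm_epi_id ax A)); split.
  by rewrite comp_idl [LHS](Z0 _).1.
move=> T f; rewrite comp_idl => ->; exists 0; split=> [|g _]; first by rewrite comp0r.
by rewrite [RHS](Z0 _).2.
Qed.

Lemma bp_inl_adm_mono A B (S : biproduct A B) : adm_mono (bp_inl S).
Proof.
have [Z Z0] := (pre_additive F).1.
exact: pushout_adm_mono (bp_inl_pushout S 0 Z0) (zero_adm_mono 0 Z0).
Qed.

(** The cokernel [z] of the identity of [A] is an admissible epic onto a zero object, and [bp_prr S]
    is a pullback of it. *)
Lemma bp_prr_adm_epi A B (S : biproduct A B) : adm_epi (bp_prr S).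
Proof.
have [Z [z Zz]] := adm_mono_id ax A.
have z0 : z = 0 by have := (conflation_ker ax Zz).1; rewrite comp_idr.
have Z0 : is_zero Z.
  have idZ : idm Z = 0.
    have [_ univ] := conflation_coker ax Zz.
    have [|w [_ wU]] := univ Z 0; first by rewrite comp0l.
    by transitivity w; [apply/esym/wU; rewrite comp_idl | apply: wU; rewrite comp0l].
  by move=> B0; split=> f; [rewrite -(comp_idr f) idZ comp0r |
    rewrite -(comp_idl f) idZ comp0l].
by apply: (pullback_adm_epi (bp_prl_pullback S z Z0)); exists A, (idm A).
Qed.

(** The first map is [bp_inl], then a shear, then the sum of [v] and an identity, hence an
    admissible monic. The pushout property says that the second map is its cokernel. *)
Lemma pushout_conflation A B A' B' (h : hom A B) (v : hom A A') (w : hom B B')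
    (h' : hom A' B') (S : biproduct A' B) :
  is_pushout h v w h' -> adm_mono v ->
  conflation (bp_inl S \oc v + bp_inr S \oc h) (w \oc bp_prr S - h' \oc bp_prl S).
Proof.
move=> [sq univ] mv; apply: adm_mono_coker.
  have [T] := (pre_additive F).2 A B.
  have -> : bp_inl S \oc v + bp_inr S \oc h =
      bp_map T S v (idm B) \oc (idm T + bp_inr T \oc h \oc bp_prl T) \oc bp_inl T.
    rewrite -!comp_assoc compDl comp_idl -!comp_assoc bp_ll comp_idr compDr.
    by rewrite !comp_assoc bp_map_inl bp_map_inr comp_idr.
  apply: (adm_mono_comp ax); first exact: bp_inl_adm_mono.
  apply: (adm_mono_comp ax); last exact: bp_map_adm_mono mv (adm_mono_id ax B).
  rewrite -[X in adm_mono X]comp_idr.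
  exact: adm_mono_iso (bp_shear_iso T h) (adm_mono_id ax T).
split.
  rewrite compBl !compDr -!comp_assoc !(comp_assoc (bp_prl S)) !(comp_assoc (bp_prr S)).
  by rewrite bp_ll bp_lr bp_rl bp_rr !comp0l !comp_idl !comp0r add0r addr0 sq subrr.
move=> T f; rewrite compDr !comp_assoc => /eqP; rewrite addr_eq0 => /eqP fE.
have [|g [[gw gh] gU]] := univ T (f \oc bp_inr S) (- (f \oc bp_inl S)).
  by rewrite compNl fE opprK.
exists g; split=> [|g' g'E].
  apply: bp_ext; rewrite -comp_assoc compBl -!comp_assoc ?bp_ll ?bp_lr ?bp_rl ?bp_rr;
    rewrite !comp0r !comp_idr ?sub0r ?subr0 //.
  by rewrite compNr gh opprK.
apply: gU; rewrite -g'E; split.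
  by rewrite -comp_assoc compBl -!comp_assoc bp_rr bp_lr comp0r comp_idr subr0.
by rewrite -comp_assoc compBl -!comp_assoc bp_ll bp_rl comp0r comp_idr sub0r compNr opprK.
Qed.

Lemma pushout_pullback A B A' B' (h : hom A B) (v : hom A A') (w : hom B B')
    (h' : hom A' B') : is_pushout h v w h' -> adm_mono v -> is_pullback h v w h'.
Proof.
move=> po mv; have [S] := (pre_additive F).2 A' B.
have [_ univ] := conflation_ker ax (pushout_conflation S po mv).
split=> [|T b a' ba]; first exact: po.1.
have [|g [gE gU]] := univ _ (bp_inl S \oc a' + bp_inr S \oc b).
  rewrite compBl !compDr -!comp_assoc !(comp_assoc (bp_prl S)) !(comp_assoc (bp_prr S)).
  by rewrite bp_ll bp_lr bp_rl bp_rr !comp0l !comp_idl !comp0r add0r addr0 ba subrr.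
exists g; split=> [|g' [g'b g'a]]; last first.
  by apply: gU; rewrite compDl -!comp_assoc g'b g'a.
split.
  have := congr1 (comp (bp_prr S)) gE; rewrite compDl !compDr !comp_assoc.
  by rewrite bp_rl bp_rr !comp0l !add0r !comp_idl.
have := congr1 (comp (bp_prl S)) gE; rewrite compDl !compDr !comp_assoc.
by rewrite bp_ll bp_lr !comp0l !addr0 !comp_idl.
Qed.

Lemma adm_epi_bp A B D (S : biproduct A B) (x : hom A D) (q : hom B D) :
  adm_epi q -> adm_epi (x \oc bp_prl S + q \oc bp_prr S).
Proof.
move=> eq; have [T] := (pre_additive F).2 A D.
have -> : x \oc bp_prl S + q \oc bp_prr S =
    bp_prr T \oc (idm T + bp_inr T \oc x \oc bp_prl T) \oc bp_map S T (idm A) q.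
  rewrite compDr comp_idr compDl !comp_assoc bp_rr comp_idl bp_map_prr.
  by rewrite -(comp_assoc x) bp_map_prl comp_idl addrC.
apply: (adm_epi_comp ax).
  rewrite -bp_map_swap.
  exact: (pullback_adm_epi (bp_map_id_pullback (bp_swap S) (bp_swap T) q)).
apply: adm_epi_iso (bp_prr_adm_epi T); exact: bp_shear_iso.
Qed.

End Exact.

(** * One step of termwise hulls, covers, extensions and lifts *)

Section Steps.
Context (K : fieldType) (F : frobeniusCat K).
Implicit Types A B D I J P X Y : F.
Let ax := exactP F.

Lemma frobeniusCat_axioms : frobenius_axioms F.
Proof.
split.
- exact: conflation_ker ax.
- exact: conflation_coker ax.
- by move=> A; have [I [i [injI [D [p ip]]]]] := enough_injectives A; exists I, D, i, p.
- move=> A; have [P [p [projP [D [i ip]]]]] := enough_projectives A.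
  by exists D, P, i, p; split=> //; apply/projective_injective.
- by move=> I injI; apply/projective_injective.
Qed.
Let FE := frobeniusCat_axioms.

(** One term of the hull of a chain. The cokernels must also map by an admissible monic, so [J'] is
    an injective hull of the pushout [P] of [e] and [x]: the cokernel of [X' -> P] is still [D], and
    [dd] is the pushout of [P -> J'] along [P -> D]. *)
Lemma injective_step X X' J D (x : hom X X') (e : hom X J) (q : hom J D) :
  adm_mono x -> conflation e q ->
  exists J' D' (e' : hom X' J') (q' : hom J' D') (jj : hom J J') (dd : hom D D'),
    [/\ injective_ob J', conflation e' q', adm_mono jj & adm_mono dd] /\
    jj \oc e = e' \oc x /\ dd \oc q = q' \oc jj.
Proof.
move=> mx eq; have me : adm_mono e by exists D, q.
have [P [e1 [x1 [po me1]]]] := adm_mono_pushout ax x me.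
have [sq univ] := po.
have mx1 : adm_mono x1.
  apply: (pushout_adm_mono (f := e) (i := x) (f' := e1)) => //.
  split=> [|T b a' ba]; first by rewrite sq.
  have [|g [[g1 g2] gU]] := univ T a' b; first by rewrite ba.
  by exists g; split=> // g' [g'1 g'2]; apply: gU.
have [J' [j [injJ' mj]]] := enough_injectives P.
have [|qq [[qq2 qq1] qqU]] := univ D 0 q.
  by rewrite comp0l (conf0 FE eq).
have [Q [dd [q' [[sq' univ'] mdd]]]] := adm_mono_pushout ax qq mj.
have cq : is_cokernel (j \oc e1) q'.
  split=> [|T f fje].
    by rewrite comp_assoc -sq' -comp_assoc qq2 comp0r.
  have [|s sE] := conf_desc (f := f \oc j \oc x1) FE eq.
    by rewrite -!comp_assoc -sq !comp_assoc -(comp_assoc f) fje comp0l.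
  have fs : f \oc j = s \oc qq.
    have [|w [_ wU]] := univ T 0 (f \oc j \oc x1).
      by rewrite comp0l sE -comp_assoc (conf0 FE eq) comp0r.
    rewrite -(wU (f \oc j)); last by rewrite -(comp_assoc f j e1).
    by apply: wU; rewrite -!(comp_assoc s) qq1 qq2 comp0r sE.
  have [g [[gd gq] gU]] := univ' _ _ _ (esym fs).
  exists g; split=> // g' g'q; apply: gU; split=> //.
  apply: (conf_epi FE eq); rewrite -qq1 !comp_assoc -fs.
  by rewrite -(comp_assoc g') sq' comp_assoc g'q.
have mje : adm_mono (j \oc e1) by exact: adm_mono_comp ax _ _ _ _ _ me1 mj.
exists J', Q, (j \oc e1), q', (j \oc x1), dd; split; first split=> //.
- exact: adm_mono_coker cq.
- exact: adm_mono_comp ax _ _ _ _ _ mx1 mj.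
split; first by rewrite -!comp_assoc sq.
by rewrite comp_assoc -sq' -comp_assoc qq1.
Qed.

(** One term of the cover of a chain, with [P'] the sum of [P] and a cover [Q] of [X']. Let [W] be
    the kernel of [Q -> X' -> Z], where [Z] is the cokernel of [x]. The kernel [O'] of [p'] is the
    pullback of [W] and [P] over [X], and [oo] is the kernel of the admissible epic [O' -> W]. *)
Lemma projective_step X X' O P (x : hom X X') (k : hom O P) (p : hom P X) :
  adm_mono x -> conflation k p -> injective_ob P ->
  exists O' P' (k' : hom O' P') (p' : hom P' X') (oo : hom O O') (pp : hom P P'),
    [/\ injective_ob P', conflation k' p', adm_mono oo & adm_mono pp] /\
    pp \oc k = k' \oc oo /\ p' \oc pp = x \oc p.
Proof.
move=> [Z [z xz]] kp injP.
have [D [Q [i [q [injQ iq]]]]] := frob_proj FE X'.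
have eq : adm_epi q by exists D, i.
have [W [w wzq]] : adm_epi (z \oc q).
  by apply: (adm_epi_comp ax eq); exists X, x.
have [|y yE] := conf_lift (f := q \oc w) FE xz.
  by rewrite comp_assoc (conf0 FE wzq).
have ep : adm_epi p by exists O, k.
have [O' [r [s [[sq univ] er]]]] := adm_epi_pullback ax y ep.
have [S] := (pre_additive F).2 P Q.
pose k' := bp_inl S \oc s - bp_inr S \oc (w \oc r).
pose p' := (x \oc p) \oc bp_prl S + q \oc bp_prr S.
have [|oo [[so ro] ooU]] := univ _ k 0; first by rewrite comp0r (conf0 FE kp).
exists O', S, k', p', oo, (bp_inl S); split; first split.
- exact: injective_bp.
- apply: adm_epi_ker; first exact: adm_epi_bp.
  split.
    rewrite /p' /k' compBr !compDl -!comp_assoc !(comp_assoc (bp_prl S)) !(comp_assoc (bp_prr S)).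
    rewrite bp_ll bp_lr bp_rl bp_rr !comp0l !comp_idl !comp0r add0r addr0.
    by rewrite sq (comp_assoc q) yE -!comp_assoc subrr.
  move=> T f; rewrite /p' compDl -!comp_assoc => fE.
  have [|g gE] := conf_lift (f := - (bp_prr S \oc f)) FE wzq.
    rewrite compNr -!comp_assoc; move/eqP: fE; rewrite addr_eq0 => /eqP fE.
    by rewrite -compNr -compNr compNr -fE !comp_assoc (conf0 FE xz) !comp0l.
  have [|h [[hs hr] hU]] := univ T (bp_prl S \oc f) g.
    apply: (conf_mono FE xz); rewrite !comp_assoc -yE -(comp_assoc q) -gE compNr.
    by apply/eqP; rewrite -addr_eq0 -!comp_assoc fE.
  exists h; split=> [|h' h'E].
    rewrite /k' compBl -!comp_assoc hs hr -gE compNr opprK !comp_assoc -compDl.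
    by rewrite bp_id comp_idl.
  apply: hU; split.
    rewrite -h'E /k' comp_assoc compBr !comp_assoc bp_ll bp_lr !comp0l comp_idl.
    by rewrite subr0.
  apply: (conf_mono FE wzq); rewrite -gE -h'E comp_assoc.
  rewrite [X in _ = - X]comp_assoc /k' compBr !(comp_assoc (bp_prr S)).
  by rewrite bp_rl bp_rr !comp0l comp_idl sub0r compNl opprK.
- exists W, r; apply: adm_epi_ker er _; split=> // T f rf.
  have [|g gE] := conf_lift (f := s \oc f) FE kp.
    by rewrite comp_assoc sq -comp_assoc rf comp0r.
  exists g; split.
    have [|v [_ vU]] := univ T (s \oc f) 0.
      by rewrite comp0r comp_assoc sq -comp_assoc rf comp0r.
    rewrite -(vU f)//; apply/esym/vU.
    by rewrite !comp_assoc so ro comp0l gE.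
  move=> g' g'f; apply: (conf_mono FE kp); rewrite -gE -g'f comp_assoc so.
  by [].
- exact: bp_inl_adm_mono.
split.
  by rewrite /k' compBl -!comp_assoc so ro !comp0r subr0.
by rewrite /p' compDl -!comp_assoc bp_ll bp_rl comp_idr comp0r addr0.
Qed.

(** Extend [phi] to any [u]. The error [u \oc jj - g] vanishes on [Y], so it comes from [D]; it
    extends along [dd] to [D'] and is subtracted. *)
Lemma extension_step Y Y' J J' D D' W (e : hom Y J) (q : hom J D)
    (e' : hom Y' J') (q' : hom J' D') (y : hom Y Y') (jj : hom J J') (dd : hom D D')
    (phi : hom Y' W) (g : hom J W) :
  conflation e q -> conflation e' q' -> adm_mono dd ->
  jj \oc e = e' \oc y -> dd \oc q = q' \oc jj -> injective_ob W ->
  g \oc e = phi \oc y -> exists g', g' \oc e' = phi /\ g' \oc jj = g.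
Proof.
move=> eq eq' mdd je dq injW ge.
have [u uE] := inj_extend phi eq' injW.
have [|s sE] := conf_desc (f := u \oc jj - g) FE eq.
  by rewrite compBl -comp_assoc je comp_assoc -uE ge subrr.
have [D2 [r ddr]] := mdd; have [s' s'E] := inj_extend s ddr injW.
exists (u - s' \oc q'); split.
  by rewrite compBl -comp_assoc (conf0 FE eq') comp0r subr0 uE.
by rewrite compBl -comp_assoc -dq comp_assoc -s'E -sE subKr.
Qed.

(** Lift [f] to any [u]. The error on [P] takes values in [A]; a retraction of [i] carries it to
    [P'], where it is subtracted. *)
Lemma lifting_step A B D P P' (a : hom A B) (b : hom B D) (i : hom P P')
    (f : hom P' D) (g : hom P B) :
  conflation a b -> adm_mono i -> injective_ob P -> injective_ob P' ->
  b \oc g = f \oc i -> exists g', b \oc g' = f /\ g' \oc i = g.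
Proof.
move=> ab mi injP injP' bg.
have [r ri] := injP _ _ i mi (idm P).
have [u uE] := proj_lift FE f ab injP'.
have [|w wE] := conf_lift (f := u \oc i - g) FE ab.
  by rewrite compBr comp_assoc -uE bg subrr.
exists (u - a \oc (w \oc r)); split.
  by rewrite compBr comp_assoc (conf0 FE ab) comp0l subr0 uE.
by rewrite compBl -!comp_assoc ri comp_idr -wE subKr.
Qed.

End Steps.

(** * Chains as sequences *)

Lemma choice_dep (I : Type) (T : I -> Type) (P : forall i, T i -> Prop) :
  (forall i, exists x, P i x) -> exists f : forall i, T i, forall i, P i (f i).
Proof.
move=> h; exists (fun i => sval (cid (h i))) => i; exact: svalP (cid (h i)).
Qed.

(** Dependent choice with values prescribed up to [j]; [P] is the invariant kept by the steps from
    [j] to [n]. *)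
Lemma dependent_recursion (T : nat -> Type) (x0 : forall i, T i)
    (P : forall i, T i -> Prop) (R : forall i, T i -> T i.+1 -> Prop) (j n : nat) :
  P j (x0 j) ->
  (forall i x, (j <= i < n)%N -> P i x -> exists y, P i.+1 y /\ R i x y) ->
  exists x : forall i, T i, (forall i, (i <= j)%N -> x i = x0 i) /\
    (forall i, (j <= i < n)%N -> P i.+1 (x i.+1) /\ R i (x i) (x i.+1)).
Proof.
move=> P0 step.
(* The step is made total: where its conditions fail it returns the default [x0 i.+1]. *)
have stepT i (x : T i) : {y : T i.+1 | (j <= i < n)%N -> P i x -> P i.+1 y /\ R i x y}.
  apply: cid; have [Px|nPx] := pselect ((j <= i < n)%N /\ P i x).
    by have [y yP] := step i x Px.1 Px.2; exists y.
  by exists (x0 i.+1) => ij Px; case: nPx.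
pose fix x i : T i := match i with
  | 0 => x0 0 | i'.+1 => if (i' < j)%N then x0 i'.+1 else sval (stepT i' (x i')) end.
have xj i : (i <= j)%N -> x i = x0 i by case: i => //= i ->.
have xS i : (j <= i)%N -> x i.+1 = sval (stepT i (x i)).
  by move=> ji /=; case: ifP => // ij; exfalso; rewrite leqNgt ij in ji.
have Px i : (j <= i < n)%N -> P i (x i).
  elim: i => [|i IH] /andP[ji ilt].
    by move: ji P0; rewrite leqn0 => /eqP ->.
  move: ji; rewrite leq_eqVlt => /orP[/eqP <-|ji]; first by rewrite xj.
  have ij : (j <= i < n)%N by rewrite -ltnS ji ltnW.
  by rewrite xS//; exact: (svalP (stepT i (x i)) ij (IH ij)).1.
exists x; split=> // i ij; rewrite xS; last by case/andP: ij.
exact: svalP (stepT i (x i)) ij (Px i ij).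
Qed.

Section Sequences.
Context (K : fieldType) (F : exactCat K).

(* Objects and morphisms are indexed by all of nat, which avoids transports
   between ordinals; only an initial segment is used. *)
Record sequence := Sequence {
  sq_ob :> nat -> F;
  sq_map : forall i, hom (sq_ob i) (sq_ob i.+1) }.

Section Composite.
Variable S : sequence.

(** An identity for equal indices and a default 0 otherwise. Through it, [cc] also serves as a cast
    between indices that are only provably equal. *)
Definition sq_cast i j : hom (S i) (S j) :=
  match @eqP nat i j with
  | ReflectT e => match e in _ = j return hom (S i) (S j) with erefl => idm (S i) end
  | ReflectF _ => 0
  end.

(* The composite S i -> S j for i <= j, and 0 otherwise. *)
Fixpoint cc i j : hom (S i) (S j) :=
  match j with
  | 0 => sq_cast i 0
  | j'.+1 => sq_cast i j'.+1 + sq_map S j' \oc cc i j'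
  end.

Lemma sq_cast_id i : sq_cast i i = idm (S i).
Proof. by rewrite /sq_cast; case: eqP => // e; rewrite (eq_irrelevance e erefl). Qed.

Lemma sq_cast_neq i j : i != j -> sq_cast i j = 0.
Proof. by rewrite /sq_cast; case: eqP. Qed.

Lemma cc_gt i j : (j < i)%N -> cc i j = 0.
Proof.
elim: j => [|j IH] ji /=; first by rewrite sq_cast_neq -?lt0n.
by rewrite IH ?comp0r ?addr0 ?sq_cast_neq ?(ltnW ji)//; rewrite gtn_eqF.
Qed.

Lemma cc_id i : cc i i = idm (S i).
Proof.
by case: i => [|i] /=; rewrite ?cc_gt// ?comp0r ?addr0 sq_cast_id.
Qed.

Lemma ccS i j : (i <= j)%N -> cc i j.+1 = sq_map S j \oc cc i j.
Proof. by move=> ij /=; rewrite sq_cast_neq ?add0r// ltn_eqF. Qed.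

Lemma cc1 i : cc i i.+1 = sq_map S i.
Proof. by rewrite ccS// cc_id comp_idr. Qed.

Lemma cc_comp i j k : (i <= j)%N -> (j <= k)%N -> cc j k \oc cc i j = cc i k.
Proof.
move=> ij; elim: k => [|k IH] jk.
  by move: jk ij; rewrite leqn0 => /eqP ->; rewrite cc_id comp_idl.
move: jk; rewrite leq_eqVlt => /orP[/eqP <-|jk]; first by rewrite cc_id comp_idl.
by rewrite !ccS ?(leq_trans ij)// -comp_assoc IH.
Qed.

Lemma cc_mono n i j :
  (forall k, (k < n)%N -> adm_mono (sq_map S k)) ->
  (i <= j)%N -> (j <= n)%N -> adm_mono (cc i j).
Proof.
move=> mS ij; elim: j ij => [|j IH] ij jn.
  by move: ij; rewrite leqn0 => /eqP ->; rewrite cc_id; exact: adm_mono_id (exactP F) _.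
move: ij; rewrite leq_eqVlt => /orP[/eqP ->|ij].
  by rewrite cc_id; exact: adm_mono_id (exactP F) _.
rewrite ccS//; apply: (adm_mono_comp (exactP F)); last exact: mS.
by apply: IH => //; exact: ltnW.
Qed.

(** Repeated values of [k] give chains with constant stretches, such as truncations; ladders between
    two reindexings of one sequence consist of composites [cc]. *)
Definition reindex (k : nat -> nat) : sequence :=
  Sequence (fun i => cc (k i) (k i.+1)).

End Composite.

Lemma index_homo n (k : nat -> nat) i j :
  (forall i, (i < n)%N -> (k i <= k i.+1)%N) -> (i <= j)%N -> (j <= n)%N ->
  (k i <= k j)%N.
Proof.
move=> kH; elim: j => [|j IH]; first by rewrite leqn0 => /eqP ->.
rewrite leq_eqVlt => /orP[/eqP -> //|ij] jn.
by rewrite (leq_trans _ (kH j jn))// IH// ltnW.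
Qed.

Lemma cc_reindex S n (k : nat -> nat) i j :
  (forall i, (i < n)%N -> (k i <= k i.+1)%N) -> (i <= j)%N -> (j <= n)%N ->
  cc (reindex S k) i j = cc S (k i) (k j).
Proof.
move=> kH; elim: j => [|j IH]; first by rewrite leqn0 => /eqP ->; rewrite !cc_id.
rewrite leq_eqVlt => /orP[/eqP ->|ij] jn; first by rewrite !cc_id.
rewrite ccS// IH ?(ltnW jn)//= cc_comp//; last exact: kH.
by apply: index_homo kH _ (ltnW jn).
Qed.

End Sequences.

Section NatChains.
Context (K : fieldType) (F : exactCat K) (l : nat).

Definition mono_sq (S : sequence F) := forall i, (i < l)%N -> adm_mono (sq_map S i).

Definition nch (S : sequence F) (mS : mono_sq S) : Morm F l :=
  @Chain K F l (fun i => S i) (fun i => sq_map S i) (fun i => mS i (ltn_ord i)).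

(** Objects are extended by [inord] and substituted first, so that the maps get the right types by
    conversion; the maps are then extended by 0. *)
Lemma nch_ind (P : Morm F l -> Prop) : (forall S (mS : mono_sq S), P (nch mS)) ->
  forall X, P X.
Proof.
move=> nchP [ob map mono].
have [N obE] : exists N : nat -> F, ob = fun i : 'I_l.+1 => N i.
  exists (fun k => ob (inord k)); apply/funext => i; by rewrite inord_val.
subst ob.
have [n nE] : exists n : forall k, hom (N k) (N k.+1), forall i : 'I_l, map i = n i.
  exists (fun k => match @idP (k < l)%N return hom (N k) (N k.+1) with
    | ReflectT h => map (Ordinal h) | ReflectF _ => 0 end).
  case=> i il /=; case: {-}_ / idP => [h|//].
  by rewrite (bool_irrelevance h il).
have mN : mono_sq (Sequence n) by move=> i il; have := mono (Ordinal il); rewrite nE.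
have mapE : map = fun i : 'I_l => n i by apply: functional_extensionality_dep.
subst map; have := nchP _ mN; congr P; rewrite /nch /=; congr Chain.
exact: Prop_irrelevance.
Qed.

Section Components.
Variables (S S' : sequence F) (mS : mono_sq S) (mS' : mono_sq S').

Implicit Types f g : chain_hom (nch mS) (nch mS').

(* The component at i, indexed by nat; it is 0 for i > l. *)
Definition nc f i : hom (S i) (S' i) :=
  match @idP (i < l.+1)%N with ReflectT h => f (Ordinal h) | ReflectF _ => 0 end.

Lemma ncE f (i : 'I_l.+1) : f i = nc f i.
Proof.
case: i => i il; rewrite /nc /=; case: {-}_ / idP => [h|//].
by rewrite (bool_irrelevance h il).
Qed.

Lemma nc_ord f i (il : (i < l.+1)%N) : nc f i = f (Ordinal il).
Proof. by rewrite ncE. Qed.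

Lemma nc_ladder f i : (i < l)%N -> nc f i.+1 \oc sq_map S i = sq_map S' i \oc nc f i.
Proof. by move=> il; have := chain_homP f (Ordinal il); rewrite !ncE. Qed.

Lemma nc_ext f g : (forall i, (i <= l)%N -> nc f i = nc g i) -> f = g.
Proof. by move=> fg; apply: chain_hom_ext => i; rewrite !ncE fg// -ltnS. Qed.

Lemma nc_cc f i j : (i <= j)%N -> (j <= l)%N ->
  nc f j \oc cc S i j = cc S' i j \oc nc f i.
Proof.
move=> ij; elim: j ij => [|j IH] ij jl.
  by move: ij; rewrite leqn0 => /eqP ->; rewrite !cc_id comp_idl comp_idr.
move: ij; rewrite leq_eqVlt => /orP[/eqP ->|ij].
  by rewrite !cc_id comp_idl comp_idr.
by rewrite !ccS// comp_assoc nc_ladder// -!comp_assoc IH// ltnW.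
Qed.

Definition mkh (phi : forall i, hom (S i) (S' i))
    (phiP : forall i, (i < l)%N -> phi i.+1 \oc sq_map S i = sq_map S' i \oc phi i) :
  chain_hom (nch mS) (nch mS') :=
  @mk_chain_hom K F l (nch mS) (nch mS') (fun i => phi i) (fun i => phiP i (ltn_ord i)).

Lemma nc_mkh phi phiP i : (i <= l)%N -> nc (@mkh phi phiP) i = phi i.
Proof. by move=> il; rewrite (nc_ord _ (il : (i < l.+1)%N)). Qed.

Lemma nc_lin a f g i : (i <= l)%N -> nc (a *: f + g) i = a *: nc f i + nc g i.
Proof. by move=> il; rewrite !(nc_ord _ (il : (i < l.+1)%N)). Qed.

Lemma nc0 i : nc 0 i = 0.
Proof. by rewrite /nc; case: {-}_ / idP. Qed.

End Components.

Lemma nc_comp S S' S2 (mS : mono_sq S) (mS' : mono_sq S') (mS2 : mono_sq S2)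
    (g : hom (nch mS') (nch mS2)) (f : hom (nch mS) (nch mS')) i :
  (i <= l)%N -> nc (g \oc f) i = nc g i \oc nc f i.
Proof. by move=> il; rewrite !(nc_ord _ (il : (i < l.+1)%N)). Qed.

Lemma nch_conflation S S' S2 (mS : mono_sq S) (mS' : mono_sq S') (mS2 : mono_sq S2)
    (f : hom (nch mS) (nch mS')) (g : hom (nch mS') (nch mS2)) :
  conflation f g <-> forall i, (i <= l)%N -> conflation (nc f i) (nc g i).
Proof.
split=> [fg i il|fg i]; last by rewrite !ncE; apply: fg; rewrite -ltnS.
have il' : (i < l.+1)%N by [].
by have := fg (Ordinal il'); rewrite !ncE.
Qed.

End NatChains.

(** * Chains form a Frobenius category *)

Section ChainsFrobenius.
Context (K : fieldType) (F : frobeniusCat K) (l : nat).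
Let FE := frobeniusCat_axioms F.
Implicit Types S Y J D W P : sequence F.

Lemma chain_conflation_kernel (X Y Z : Morm F l) (i : hom X Y) (p : hom Y Z) :
  conflation i p -> is_kernel i p.
Proof.
elim/(@nch_ind K F l): X i => S mS i.
elim/(@nch_ind K F l): Y i p => S1 mS1 i p.
elim/(@nch_ind K F l): Z p => S2 mS2 p /nch_conflation ip.
split.
  apply: nc_ext => j jl; rewrite nc_comp// (conf0 FE (ip _ jl)).
  by rewrite nc0.
elim/(@nch_ind K F l) => T mT f pf.
have /choice_dep[g gE] : forall j, exists g, (j <= l)%N -> nc f j = nc i j \oc g.
  move=> j; have [jl|] := leqP j l; last by exists 0.
  have [|g ->] := conf_lift (f := nc f j) FE (ip _ jl); last by exists g.
  by rewrite -nc_comp// pf nc0.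
have gP j : (j < l)%N -> g j.+1 \oc sq_map T j = sq_map S j \oc g j.
  move=> jl; apply: (conf_mono FE (ip _ jl)).
  by rewrite !comp_assoc -gE// nc_ladder// nc_ladder// -comp_assoc -gE// ltnW.
exists (mkh mT mS gP); split=> [|g' g'E].
  by apply: nc_ext => j jl; rewrite nc_comp// nc_mkh// gE.
apply: nc_ext => j jl; rewrite nc_mkh//; apply: (conf_mono FE (ip _ jl)).
by rewrite -gE// -g'E nc_comp.
Qed.

Lemma chain_conflation_cokernel (X Y Z : Morm F l) (i : hom X Y) (p : hom Y Z) :
  conflation i p -> is_cokernel i p.
Proof.
elim/(@nch_ind K F l): X i => S mS i.
elim/(@nch_ind K F l): Y i p => S1 mS1 i p.
elim/(@nch_ind K F l): Z p => S2 mS2 p /nch_conflation ip.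
split.
  apply: nc_ext => j jl; rewrite nc_comp// (conf0 FE (ip _ jl)).
  by rewrite nc0.
elim/(@nch_ind K F l) => T mT f pf.
have /choice_dep[g gE] : forall j, exists g, (j <= l)%N -> nc f j = g \oc nc p j.
  move=> j; have [jl|] := leqP j l; last by exists 0.
  have [|g ->] := conf_desc (f := nc f j) FE (ip _ jl); last by exists g.
  by rewrite -nc_comp// pf nc0.
have gP j : (j < l)%N -> g j.+1 \oc sq_map S2 j = sq_map T j \oc g j.
  move=> jl; apply: (conf_epi FE (ip _ (ltnW jl))).
  by rewrite -!comp_assoc -gE ?(ltnW jl)// -nc_ladder// -nc_ladder// comp_assoc -gE.
exists (mkh mS2 mT gP); split=> [|g' g'E].
  by apply: nc_ext => j jl; rewrite nc_comp// nc_mkh// gE.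
apply: nc_ext => j jl; rewrite nc_mkh//; apply: (conf_epi FE (ip _ jl)).
by rewrite -gE// -g'E nc_comp.
Qed.

(** The prescribed part is continued beyond [j] by [extension_step], which applies because the maps
    of [D] are admissible monics. *)
Lemma chain_extend Y J D W (mY : mono_sq l Y) (mJ : mono_sq l J) (mD : mono_sq l D)
    (mW : mono_sq l W) (e : hom (nch mY) (nch mJ)) (q : hom (nch mJ) (nch mD))
    (phi : hom (nch mY) (nch mW)) (g0 : forall i, hom (J i) (W i)) j :
  conflation e q -> (j <= l)%N ->
  (forall i, (i <= j)%N -> g0 i \oc nc e i = nc phi i) ->
  (forall i, (i < j)%N -> g0 i.+1 \oc sq_map J i = sq_map W i \oc g0 i) ->
  (forall i, (j < i <= l)%N -> injective_ob (W i)) ->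
  exists g : hom (nch mJ) (nch mW), g \oc e = phi /\
    forall i, (i <= j)%N -> nc g i = g0 i.
Proof.
move=> /nch_conflation eq jl g0e g0P injW.
have [||g [gj gP]] := dependent_recursion (T := fun i => hom (J i) (W i)) (x0 := g0)
  (P := fun i g => g \oc nc e i = nc phi i)
  (R := fun i g g' => g' \oc sq_map J i = sq_map W i \oc g) (j := j) (n := l).
- exact: g0e.
- move=> i g /andP[ji il] ge.
  apply: (extension_step (y := sq_map Y i) (eq i (ltnW il)) (eq i.+1 il) (mD i il)).
  + by rewrite nc_ladder.
  + by rewrite nc_ladder.
  + by apply: injW; rewrite ltnS ji.
  + by rewrite -comp_assoc ge nc_ladder.
have gE i : (i <= l)%N -> g i \oc nc e i = nc phi i.
  move=> il; have [ij|] := leqP i j; first by rewrite gj// g0e.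
  by case: i il => // i il ji; apply: (gP i _).1; rewrite -ltnS ji il.
have gL i : (i < l)%N -> g i.+1 \oc sq_map J i = sq_map W i \oc g i.
  move=> il; have [ij|ji] := ltnP i j; first by rewrite !gj ?(ltnW ij)// g0P.
  by apply: (gP i _).2; rewrite ji.
exists (mkh mJ mW gL); split.
  by apply: nc_ext => i il; rewrite nc_comp// nc_mkh// gE.
by move=> i ij; rewrite nc_mkh ?gj// (leq_trans ij).
Qed.

(** Term 0 is any hull in [F]. Each later one comes from [injective_step], so that the cokernels
    again form a chain of admissible monics. *)
Lemma chain_injective_hull (X : Morm F l) :
  exists J (mJ : mono_sq l J) (D : Morm F l) (e : hom X (nch mJ)) (q : hom (nch mJ) D),
    (forall i, (i <= l)%N -> injective_ob (J i)) /\ conflation e q.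
Proof.
elim/(@nch_ind K F l): X => S mS.
pose T i := {J : F & {D : F & (hom (S i) J * hom J D)%type}}.
pose P i (x : T i) := injective_ob (tag x) /\
  conflation (tagged (tagged x)).1 (tagged (tagged x)).2.
have hull i : exists x : T i, P i x.
  have [J [D [e [q eq]]]] := frob_inj FE (S i).
  by exists (existT _ J (existT _ D (e, q))).
have [x0 x0P] := choice_dep hull.
pose R i (x : T i) (y : T i.+1) := exists (jj : hom (tag x) (tag y))
  (dd : hom (tag (tagged x)) (tag (tagged y))),
  [/\ adm_mono jj, adm_mono dd,
    jj \oc (tagged (tagged x)).1 = (tagged (tagged y)).1 \oc sq_map S i &
    dd \oc (tagged (tagged x)).2 = (tagged (tagged y)).2 \oc jj].
have [||x [x0E xP]] := dependent_recursion (T := T) (x0 := x0) (P := P) (R := R)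
  (j := 0) (n := l) => //.
- move=> i [J [D [e q]]] il [/= injJ eq].
  have [J' [D' [e' [q' [jj [dd [[i1 i2 i3 i4] [i5 i6]]]]]]]] := injective_step (mS i il) eq.
  exists (existT _ J' (existT _ D' (e', q'))); split; first by split.
  by exists jj, dd.
have Px i : (i <= l)%N -> P i (x i).
  by case: i => [|i] il; [rewrite x0E | exact: (xP i il).1].
have /choice_dep[jj /choice_dep[dd jd]] : forall i, exists jj, exists dd, (i < l)%N ->
    [/\ adm_mono jj, adm_mono dd,
    jj \oc (tagged (tagged (x i))).1 = (tagged (tagged (x i.+1))).1 \oc sq_map S i &
    dd \oc (tagged (tagged (x i))).2 = (tagged (tagged (x i.+1))).2 \oc jj].
  move=> i; have [il|] := ltnP i l; last by exists 0, 0.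
  by have [jj [dd jd]] := (xP i il).2; exists jj, dd.
have mJ : mono_sq l (Sequence jj) by move=> i il; have [] := jd i il.
have mD : mono_sq l (Sequence dd) by move=> i il; have [] := jd i il.
have eL i : (i < l)%N ->
    (tagged (tagged (x i.+1))).1 \oc sq_map S i = jj i \oc (tagged (tagged (x i))).1.
  by move=> il; have [_ _ ->] := jd i il.
have qL i : (i < l)%N ->
    (tagged (tagged (x i.+1))).2 \oc jj i = dd i \oc (tagged (tagged (x i))).2.
  by move=> il; have [_ _ _ ->] := jd i il.
exists (Sequence jj), mJ, (nch mD), (mkh mS mJ eL), (mkh mJ mD qL).
split; first by move=> i il; exact: (Px i il).1.
by apply/nch_conflation => i il; rewrite !nc_mkh//; exact: (Px i il).2.
Qed.

Lemma chain_projective_cover (X : Morm F l) :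
  exists P (mP : mono_sq l P) (D : Morm F l) (k : hom D (nch mP)) (p : hom (nch mP) X),
    (forall i, (i <= l)%N -> injective_ob (P i)) /\ conflation k p.
Proof.
elim/(@nch_ind K F l): X => S mS.
pose T i := {O : F & {P : F & (hom O P * hom P (S i))%type}}.
pose P i (x : T i) := injective_ob (tag (tagged x)) /\
  conflation (tagged (tagged x)).1 (tagged (tagged x)).2.
have cover i : exists x : T i, P i x.
  have [O [Q [k [p kp]]]] := frob_proj FE (S i).
  by exists (existT _ O (existT _ Q (k, p))).
have [x0 x0P] := choice_dep cover.
pose R i (x : T i) (y : T i.+1) := exists (oo : hom (tag x) (tag y))
  (pp : hom (tag (tagged x)) (tag (tagged y))),
  [/\ adm_mono oo, adm_mono pp,
    pp \oc (tagged (tagged x)).1 = (tagged (tagged y)).1 \oc oo &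
    (tagged (tagged y)).2 \oc pp = sq_map S i \oc (tagged (tagged x)).2].
have [||x [x0E xP]] := dependent_recursion (T := T) (x0 := x0) (P := P) (R := R)
  (j := 0) (n := l) => //.
- move=> i [O [Q [k p]]] il [/= injQ kp].
  have [O' [Q' [k' [p' [oo [pp [[i1 i2 i3 i4] [i5 i6]]]]]]]] :=
    projective_step (mS i il) kp injQ.
  exists (existT _ O' (existT _ Q' (k', p'))); split; first by split.
  by exists oo, pp.
have Px i : (i <= l)%N -> P i (x i).
  by case: i => [|i] il; [rewrite x0E | exact: (xP i il).1].
have /choice_dep[oo /choice_dep[pp op]] : forall i, exists oo, exists pp, (i < l)%N ->
    [/\ adm_mono oo, adm_mono pp,
    pp \oc (tagged (tagged (x i))).1 = (tagged (tagged (x i.+1))).1 \oc oo &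
    (tagged (tagged (x i.+1))).2 \oc pp = sq_map S i \oc (tagged (tagged (x i))).2].
  move=> i; have [il|] := ltnP i l; last by exists 0, 0.
  by have [oo [pp op]] := (xP i il).2; exists oo, pp.
have mP : mono_sq l (Sequence pp) by move=> i il; have [] := op i il.
have mO : mono_sq l (Sequence oo) by move=> i il; have [] := op i il.
have kL i : (i < l)%N ->
    (tagged (tagged (x i.+1))).1 \oc oo i = pp i \oc (tagged (tagged (x i))).1.
  by move=> il; have [_ _ ->] := op i il.
have pL i : (i < l)%N ->
    (tagged (tagged (x i.+1))).2 \oc pp i = sq_map S i \oc (tagged (tagged (x i))).2.
  by move=> il; have [_ _ _ ->] := op i il.
exists (Sequence pp), mP, (nch mO), (mkh mO mP kL), (mkh mP mS pL).
split; first by move=> i il; exact: (Px i il).1.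
by apply/nch_conflation => i il; rewrite !nc_mkh//; exact: (Px i il).2.
Qed.

Lemma chain_termwise_injective W (mW : mono_sq l W) :
  (forall i, (i <= l)%N -> injective_ob (W i)) -> injective_ob (nch mW).
Proof.
move=> injW X Y i [Z [p]].
elim/(@nch_ind K F l): X i => X mX i.
elim/(@nch_ind K F l): Y i p => Y mY i p.
elim/(@nch_ind K F l): Z p => Z mZ p ip f.
have /nch_conflation ip' := ip.
have [g0 g0E] := inj_extend (nc f 0) (ip' 0%N (leq0n l)) (injW 0%N (leq0n l)).
(* Only the value at 0 counts: [chain_extend] is started there. *)
pose g k : hom (Y k) (W k) := if k is 0 then g0 else 0.
have [||||h [hf _]] := chain_extend (j := 0) (phi := f) (g0 := g) ip => //.
- by move=> [].
- by move=> k /andP[_]; exact: injW.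
- by exists h.
Qed.

(** A lift at 0 is continued by [lifting_step], whose retractions exist because the terms of [P] are
    injective. *)
Lemma chain_termwise_projective P (mP : mono_sq l P) :
  (forall i, (i <= l)%N -> injective_ob (P i)) -> projective_ob (nch mP).
Proof.
move=> injP Y Z p [X [i]].
elim/(@nch_ind K F l): X i => X mX i.
elim/(@nch_ind K F l): Y i p => Y mY i p.
elim/(@nch_ind K F l): Z p => Z mZ p /nch_conflation ip f.
have [g0 g0E] := proj_lift FE (nc f 0) (ip 0%N (leq0n l)) (injP 0%N (leq0n l)).
pose g k : hom (P k) (Y k) := if k is 0 then g0 else 0.
have [||h [hg hP]] := dependent_recursion (T := fun i => hom (P i) (Y i)) (x0 := g)
  (P := fun i g => nc p i \oc g = nc f i)
  (R := fun i g g' => g' \oc sq_map P i = sq_map Y i \oc g) (j := 0) (n := l).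
- by rewrite g0E.
- move=> k u kl uE; apply: (lifting_step (ip k.+1 kl) (mP k kl)) => //.
  + by apply: injP; exact: ltnW.
  + exact: injP.
  + by rewrite comp_assoc nc_ladder// -comp_assoc uE nc_ladder.
have hE k : (k <= l)%N -> nc p k \oc h k = nc f k.
  by case: k => [|k] kl; [rewrite hg// g0E | exact: (hP k kl).1].
have hL k : (k < l)%N -> h k.+1 \oc sq_map P k = sq_map Y k \oc h k.
  by move=> kl; exact: (hP k kl).2.
exists (mkh mP mY hL); apply: nc_ext => k kl.
by rewrite nc_comp// nc_mkh// hE.
Qed.

Lemma injective_retract (C : preExactCat K) (I J : C) (i : hom I J) (r : hom J I) :
  r \oc i = idm I -> injective_ob J -> injective_ob I.
Proof.
move=> ri injJ A B j mj f; have [g gj] := injJ _ _ j mj (i \oc f).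
by exists (r \oc g); rewrite -comp_assoc gj comp_assoc ri comp_idl.
Qed.

(** An injective chain is a retract of its hull, whose terms are injective. *)
Lemma chain_injective_termwise W (mW : mono_sq l W) :
  injective_ob (nch mW) -> forall i, (i <= l)%N -> injective_ob (W i).
Proof.
move=> injW; have [J [mJ [D [e [q [injJ eq]]]]]] := chain_injective_hull (nch mW).
have [|r re] := injW _ _ e _ (idm _); first by exists D, q.
move=> i il; apply: (injective_retract (i := nc e i) (r := nc r i)) (injJ i il).
by rewrite -nc_comp// re; rewrite (nc_ord _ (il : (i < l.+1)%N)).
Qed.

Lemma chain_frobenius : frobenius_axioms (Morm F l).
Proof.
split.
- exact: chain_conflation_kernel.
- exact: chain_conflation_cokernel.
- move=> X; have [J [mJ [D [e [q [injJ eq]]]]]] := chain_injective_hull X.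
  by exists (nch mJ), D, e, q; split=> //; exact: chain_termwise_injective.
- move=> X; have [P [mP [D [k [p [injP kp]]]]]] := chain_projective_cover X.
  by exists D, (nch mP), k, p; split=> //; exact: chain_termwise_injective.
- elim/(@nch_ind K F l) => W mW injW; apply: chain_termwise_projective.
  exact: chain_injective_termwise injW.
Qed.

End ChainsFrobenius.

(** * Traces concentrated in one component *)

Section Component.
Context (K : fieldType) (F : frobeniusCat K) (l j : nat).
Hypothesis jl : (j <= l)%N.
Let FE := frobeniusCat_axioms F.
Implicit Types S Y J D W P : sequence F.

Section Coconstant.
Variables (W : sequence F) (mW : mono_sq l W).
Hypothesis isoW : forall i, (i <= j)%N -> is_iso (cc W i j).
Hypothesis injW : forall i, (j < i <= l)%N -> injective_ob (W i).

(** With [W] constant up to [j], a map at [j] spreads to each [i <= j]: go to [J j], apply [g],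
    return by the inverse isomorphism. The last clause passes a factorization at [j] down to [i]. *)
Lemma coconstant_family : exists c : forall J, hom (J j) (W j) -> forall i, hom (J i) (W i),
  forall J (g : hom (J j) (W j)), [/\ c J g j = g,
    forall i, (i < j)%N -> c J g i.+1 \oc sq_map J i = sq_map W i \oc c J g i &
    forall Y (e : forall i, hom (Y i) (J i)) (phi : forall i, hom (Y i) (W i)) i,
      (i <= j)%N -> e j \oc cc Y i j = cc J i j \oc e i ->
      phi j \oc cc Y i j = cc W i j \oc phi i ->
      g \oc e j = phi j -> c J g i \oc e i = phi i].
Proof.
have /choice_dep[inv invP] : forall i, exists v : hom (W j) (W i), (i <= j)%N ->
    v \oc cc W i j = idm _ /\ cc W i j \oc v = idm _.
  move=> i; have [ij|] := leqP i j; last by exists 0.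
  by have [v vP] := isoW ij; exists v.
have invj : inv j = idm _ by have [] := invP j (leqnn j); rewrite cc_id comp_idr.
exists (fun J g i => inv i \oc g \oc cc J i j) => J g; split.
- by rewrite cc_id comp_idr invj comp_idl.
- move=> i ij; rewrite -comp_assoc -cc1 cc_comp// [RHS]comp_assoc -cc1.
  rewrite [in RHS](comp_assoc (cc W i i.+1)).
  congr (_ \oc g \oc _); have [iL _] := invP _ ij; have [_ iR] := invP _ (ltnW ij).
  rewrite -[RHS]comp_idl -iL -comp_assoc (comp_assoc (cc W i.+1 j)) cc_comp// iR.
  by rewrite comp_idr.
move=> Y e phi i ij ecc pcc ge.
rewrite -!comp_assoc -ecc (comp_assoc g) ge pcc comp_assoc.
by rewrite (invP _ ij).1 comp_idl.
Qed.

Lemma coconstant_surj Y (mY : mono_sq l Y) (g : hom (Y j) (W j)) :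
  exists phi : hom (nch mY) (nch mW), nc phi j = g.
Proof.
have [c cP] := coconstant_family; have [cj cL _] := cP Y g.
have [||f [fj fP]] := dependent_recursion (T := fun i => hom (Y i) (W i)) (x0 := c Y g)
  (P := fun _ _ => True)
  (R := fun i g g' => g' \oc sq_map Y i = sq_map W i \oc g) (j := j) (n := l) => //.
  move=> i u /andP[ji il] _.
  have injWi : injective_ob (W i.+1) by apply: injW; rewrite ltnS ji.
  by have [v vE] := injWi _ _ _ (mY i il) (sq_map W i \oc u); exists v.
have fL i : (i < l)%N -> f i.+1 \oc sq_map Y i = sq_map W i \oc f i.
  move=> il; have [ij|ji] := ltnP i j; first by rewrite !fj ?(ltnW ij)// cL.
  by apply: (fP i _).2; rewrite ji.
by exists (mkh mY mW fL); rewrite nc_mkh// fj.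
Qed.

(** The component at [j] extends over the hull of [Y]. [coconstant_family] treats the indices below
    [j] and [chain_extend] those above, so [phi] factors through the hull. *)
Lemma coconstant_ideal Y (mY : mono_sq l Y) (phi : hom (nch mY) (nch mW)) :
  inj_ideal _ _ (nc phi j) -> inj_ideal _ _ phi.
Proof.
move=> phiI; have [J [mJ [D [e [q [injJ eq]]]]]] := chain_injective_hull (nch mY).
elim/(@nch_ind K F l): D q eq => D mD q eq; have /nch_conflation eq' := eq.
have [g [_ gE]] := ideal_extend (eq' j jl) phiI.
have [c cP] := coconstant_family; have [cj cL ce] := cP J g.
have [|||u [ue _]] := chain_extend (g0 := c J g) (phi := phi) (mW := mW) eq jl.
- by move=> i ij; apply: (ce Y (nc e) (nc phi)) => //; rewrite nc_cc.
- exact: cL.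
- exact: injW.
by rewrite -ue; apply: ideal_inj; exact: chain_termwise_injective.
Qed.

End Coconstant.

Section Constant.
Variables (V : sequence F) (mV : mono_sq l V).
Hypothesis zeroV : forall i, (i < j)%N -> is_zero (V i).
Hypothesis isoV : forall i, (j <= i <= l)%N -> is_iso (cc V j i).

Lemma constant_family : exists inv : forall i, hom (V i) (V j), inv j = idm _ /\
  (forall i, (j <= i <= l)%N -> cc V j i \oc inv i = idm _) /\
  forall Y (mY : mono_sq l Y) (g : hom (V j) (Y j)) i, (i < l)%N ->
    cc Y j i.+1 \oc g \oc inv i.+1 \oc sq_map V i = sq_map Y i \oc (cc Y j i \oc g \oc inv i).
Proof.
have /choice_dep[inv invP] : forall i, exists v : hom (V i) (V j), (j <= i <= l)%N ->
    v \oc cc V j i = idm _ /\ cc V j i \oc v = idm _.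
  move=> i; have [ij|] := boolP (j <= i <= l)%N; last by exists 0.
  by have [v vP] := isoV ij; exists v.
exists inv; split.
  by have [] := invP j; rewrite ?leqnn// cc_id comp_idr.
split=> [i /invP[]//|Y mY g i il].
have [ij|ji] := ltnP i j; first by rewrite [LHS](zeroV ij _).1 [RHS](zeroV ij _).1.
rewrite ccS// -!comp_assoc; congr (_ \oc (_ \oc (_ \oc _))).
have [|_ iR] := invP i; first by rewrite ji ltnW.
have [|iL _] := invP i.+1; first by rewrite il (leq_trans ji).
rewrite -[LHS]comp_idr -iR -comp_assoc (comp_assoc (sq_map V i)) -ccS// comp_assoc.
by rewrite iL comp_idl.
Qed.

Lemma constant_surj Y (mY : mono_sq l Y) (g : hom (V j) (Y j)) :
  exists phi : hom (nch mV) (nch mY), nc phi j = g.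
Proof.
have [inv [invj [_ invL]]] := constant_family.
exists (mkh mV mY (invL _ mY g)).
by rewrite nc_mkh// cc_id comp_idl invj comp_idr.
Qed.

(** The component at [j] lifts to a projective cover of [Y], and constancy of [V] from [j] on
    spreads the lift to a ladder. *)
Lemma constant_ideal Y (mY : mono_sq l Y) (phi : hom (nch mV) (nch mY)) :
  inj_ideal _ _ (nc phi j) -> inj_ideal _ _ phi.
Proof.
move=> phiI; have [P [mP [D [k [p [injP kp]]]]]] := chain_projective_cover (nch mY).
elim/(@nch_ind K F l): D k kp => D mD k /nch_conflation kp.
have [g [_ gE]] := ideal_lift FE (kp j jl) phiI.
have [inv [invj [invR invL]]] := constant_family.
suff -> : phi = p \oc mkh mV mP (invL _ mP g).
  by apply: ideal_inj; exact: chain_termwise_injective.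
apply: nc_ext => i il; rewrite nc_comp// nc_mkh//.
have [ij|ji] := ltnP i j; first by rewrite [LHS](zeroV ij _).1 [RHS](zeroV ij _).1.
rewrite !comp_assoc nc_cc// -(comp_assoc (cc Y j i)) -gE -nc_cc// -comp_assoc invR ?ji//.
by rewrite comp_idr.
Qed.

End Constant.

(** Taking the component at [j] identifies, stably, maps out of [V] with maps out of [V j], and maps
    into [W] with maps into [W j]. Hence the pairing stays perfect. *)
Lemma dualizes_component V W (mV : mono_sq l V) (mW : mono_sq l W)
    (t : dual (hom (V j) (W j))) :
  (forall i, (i < j)%N -> is_zero (V i)) ->
  (forall i, (j <= i <= l)%N -> is_iso (cc V j i)) ->
  (forall i, (i <= j)%N -> is_iso (cc W i j)) ->
  (forall i, (j < i <= l)%N -> injective_ob (W i)) ->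
  dualizes t ->
  exists T : dual (hom (nch mV) (nch mW)), dualizes T /\
    forall phi, T phi = t (nc phi j).
Proof.
move=> zeroV isoV isoW injW [t0 t_inj t_surj].
pose T' (phi : hom (nch mV) (nch mW)) : K^o := t (nc phi j).
have T'_lin : linear T' by move=> a f g; rewrite /T' nc_lin// linearP.
pose TL := GRing.isLinear.Build K _ K^o *:%R T' T'_lin.
pose T : dual (hom (nch mV) (nch mW)) := HB.pack T' TL.
have TE phi : T phi = t (nc phi j) by [].
exists T; split=> //; split.
- move=> f [I [u [v]]]; elim/(@nch_ind K F l): I u v => I mI u v [injI ->].
  rewrite TE nc_comp//; apply: t0; apply: ideal_inj.
  exact: chain_injective_termwise injI _ _.
- elim/(@nch_ind K F l) => Y mY g gP.
  apply: coconstant_ideal => //; apply: t_inj => h.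
  have [h' <-] := constant_surj mV zeroV isoV mY h.
  by rewrite -nc_comp// -TE gP.
- elim/(@nch_ind K F l) => Y mY xi xi0.
  have [|a u h v h' -> ->|h h0|x xP] := extend_functional
      (R := fun (u : hom (V j) (Y j)) (h : hom (nch mV) (nch mY)) => u = nc h j) (t := xi).
  + by rewrite nc0.
  + by rewrite nc_lin.
  + apply: xi0; apply: constant_ideal => //; rewrite -h0; exact: sub_mem0.
  have [u uI|g gP] := t_surj _ x.
    have [h hE] := constant_surj mV zeroV isoV mY u; rewrite (xP _ h)//.
    by apply: xi0; apply: constant_ideal => //; rewrite hE.
  have [phi phiE] := coconstant_surj mW isoW injW mY g.
  exists phi => h; rewrite TE nc_comp// phiE gP; exact: xP.
Qed.

End Component.

(** * The induction along the columns *)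

Section Reindexing.
Context (K : fieldType) (F : frobeniusCat K) (l : nat).
Implicit Types S : sequence F.
Implicit Types k : nat -> nat.

Definition mono_index k := forall i, (i < l)%N -> (k i <= k i.+1)%N.

Lemma reindex_mono S n k : (forall i, (i < n)%N -> adm_mono (sq_map S i)) ->
  mono_index k -> (forall i, (i <= l)%N -> (k i <= n)%N) -> mono_sq l (reindex S k).
Proof. by move=> mS kH kn i il; apply: (cc_mono mS); [exact: kH | exact: kn]. Qed.

Lemma reindex_hom S k k' (mk : mono_sq l (reindex S k)) (mk' : mono_sq l (reindex S k')) :
  mono_index k -> mono_index k' -> (forall i, (i <= l)%N -> (k i <= k' i)%N) ->
  exists f : hom (nch mk) (nch mk'), forall i, (i <= l)%N -> nc f i = cc S (k i) (k' i).
Proof.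
move=> kH k'H kk'.
have fL i : (i < l)%N -> cc S (k i.+1) (k' i.+1) \oc sq_map (reindex S k) i =
    sq_map (reindex S k') i \oc cc S (k i) (k' i).
  by move=> il /=; rewrite !cc_comp// ?kH ?k'H ?kk'// ltnW.
by exists (mkh mk mk' fL) => i il; rewrite nc_mkh.
Qed.

Lemma cc_pushout S a b c d : (a <= b)%N -> (a <= c)%N ->
  (a = c /\ b = d) \/ (a = b /\ c = d) ->
  is_pushout (cc S a c) (cc S a b) (cc S c d) (cc S b d).
Proof.
move=> ab ac [[-> ->]|[-> ->]]; rewrite !cc_id; first exact: pushout_idh.
exact: pushout_idv.
Qed.

(** Moves the component that a trace reads off to a later index, along stretches where the chains
    are constant. *)
Lemma cc_slide S S' (a b k0 k1 m0 m1 : nat) (f0 : hom (S k0) (S' m0)) (f1 : hom (S k1) (S' m1)) :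
  (a <= k0 <= k1)%N -> (m0 <= m1 <= b)%N ->
  f1 \oc cc S k0 k1 = cc S' m0 m1 \oc f0 ->
  cc S' m0 b \oc f0 \oc cc S a k0 = cc S' m1 b \oc f1 \oc cc S a k1.
Proof.
move=> /andP[ak kk] /andP[mm mb] ff.
by rewrite -(cc_comp S' mm mb) -(cc_comp S ak kk) !comp_assoc -(comp_assoc _ f1) ff
  !comp_assoc.
Qed.

Lemma chain_pushout_conflation (A B A' B' : Morm F l) (h : hom A B) (v : hom A A')
    (w : hom B B') (h' : hom A' B') (S : forall i, biproduct (ch_ob A' i) (ch_ob B i)) :
  (forall i, is_pushout (chain_fun h i) (chain_fun v i) (chain_fun w i) (chain_fun h' i)) ->
  (forall i, adm_mono (chain_fun v i)) ->
  conflation (bp_inl (chain_bp S) \oc v + bp_inr (chain_bp S) \oc h :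
      hom A (chain_bp S : Morm F l))
    (w \oc bp_prr (chain_bp S) - h' \oc bp_prl (chain_bp S) : hom (chain_bp S : Morm F l) B').
Proof. by move=> po mv i; exact: pushout_conflation (S i) (po i) (mv i). Qed.

Lemma dualizes_cast S S' a a' b b' (t : dual (hom (S a) (S' b))) :
  a = a' -> b = b' -> dualizes t ->
  exists t' : dual (hom (S a') (S' b')), dualizes t' /\
    forall phi, t' phi = t (cc S' b' b \oc phi \oc cc S a a').
Proof.
move=> <- <- dt; exists t; split=> // phi.
by rewrite !cc_id comp_idl comp_idr.
Qed.

Lemma is_iso_cc S a b : a = b -> is_iso (cc S a b).
Proof. by move=> ->; rewrite cc_id; exact: is_iso_id. Qed.

Lemma dualizes_reindex S S' k k' (mk : mono_sq l (reindex S k))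
    (mk' : mono_sq l (reindex S' k')) j a b (t : dual (hom (S a) (S' b))) :
  (j <= l)%N -> mono_index k -> mono_index k' ->
  (forall i, (i < j)%N -> is_zero (S (k i))) ->
  (forall i, (j <= i <= l)%N -> k i = a) ->
  (forall i, (i <= j)%N -> k' i = b) ->
  (forall i, (j < i <= l)%N -> injective_ob (S' (k' i))) ->
  dualizes t ->
  exists T : dual (hom (nch mk) (nch mk')), dualizes T /\
    forall phi, T phi = t (cc S' (k' j) b \oc nc phi j \oc cc S a (k j)).
Proof.
move=> jl kH k'H zeroS ka k'b injS' dt.
have kj : k j = a by apply: ka; rewrite leqnn.
have k'j : k' j = b by exact: k'b.
have [t' [dt' t'E]] := dualizes_cast (esym kj) (esym k'j) dt.
have [||||T [dT TE]] := dualizes_component (t := t') jl mk mk' _ _ _ _ dt'.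
- exact: zeroS.
- move=> i ji; rewrite (cc_reindex _ kH); [|lia|lia].
  have e : k j = k i by rewrite kj ka.
  exact: (is_iso_cc S e).
- move=> i ij; rewrite (cc_reindex _ k'H)//.
  have e : k' i = k' j by rewrite k'j k'b.
  exact: (is_iso_cc S' e).
- exact: injS'.
by exists T; split=> // phi; rewrite TE t'E.
Qed.

End Reindexing.

(* The chains P and Q are the reindexings of augment and column by step m v. *)
Definition step m v i := if (i < m)%N then 0%N else v.

(** * Truncations of the chain against columns of the diagram *)

Section Diagram.
Context (K : fieldType) (F : frobeniusCat K) (l : nat).
Variables (S : sequence F) (mS : mono_sq l S) (D : dual_diagram (nch mS)).
Variables (Z : F) (Z0 : is_zero Z).

(** Index 0 holds the zero object and [S i] sits at [i.+1], so a reindexing that takes the value 0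
    produces the zero terms of P_m(A). *)
Definition augment : sequence F :=
  @Sequence K F (fun i => if i is i'.+1 then S i' else Z)
    (fun i => if i is i'.+1 return hom (if i is i'.+1 then S i' else Z) (S i)
              then sq_map S i' else 0).

Definition column j : sequence F :=
  Sequence (fun i => dg_ver D i j : hom (dg_ob D i j) (dg_ob D i.+1 j)).

Lemma augment_mono i : (i < l.+1)%N -> adm_mono (sq_map augment i).
Proof. by case: i => [_|i il] /=; [exact: zero_adm_mono | exact: mS]. Qed.

(** A column [j < l] ends at index [j.+1], in I^j, but column [l] ends at index [l]; hence the
    minimum. *)
Lemma column_mono j i : (j <= l)%N -> (i < minn j.+1 l)%N -> adm_mono (sq_map (column j) i).
Proof. by move=> jl; rewrite leq_min ltnS => /andP[ij il]; exact: dg_ver_mono. Qed.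

Lemma augment_reindex_mono k : mono_index l k ->
  (forall i, (i <= l)%N -> (k i <= l.+1)%N) -> mono_sq l (reindex augment k).
Proof. exact: reindex_mono augment_mono. Qed.

Lemma column_reindex_mono j k : (j <= l)%N -> mono_index l k ->
  (forall i, (i <= l)%N -> (k i <= minn j.+1 l)%N) -> mono_sq l (reindex (column j) k).
Proof. by move=> jl; apply: reindex_mono => i; exact: column_mono. Qed.

Lemma hor_cc j a b : (j < l)%N -> (a <= b)%N -> (b <= j.+1)%N ->
  dg_hor D b j \oc cc (column j) a b = cc (column j.+1) a b \oc dg_hor D a j.
Proof.
move=> jl; elim: b => [|b IH].
  by rewrite leqn0 => /eqP -> _; rewrite !cc_id comp_idl comp_idr.
rewrite leq_eqVlt => /orP[/eqP -> _|ab bj]; first by rewrite !cc_id comp_idl comp_idr.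
rewrite !ccS// -comp_assoc -IH//; last exact: ltnW.
by rewrite !comp_assoc /= (dg_bicartesian D _ _).1.1.
Qed.

Lemma hor_pushout j a b : (j < l)%N -> (a <= b)%N -> (b <= j.+1)%N ->
  is_pushout (dg_hor D a j) (cc (column j) a b) (cc (column j.+1) a b) (dg_hor D b j).
Proof.
move=> jl; elim: b => [|b IH].
  by rewrite leqn0 => /eqP -> _; rewrite !cc_id; exact: pushout_idv.
rewrite leq_eqVlt => /orP[/eqP -> _|ab bj]; first by rewrite !cc_id; exact: pushout_idv.
rewrite !ccS//; apply: (pushout_paste (IH ab (ltnW bj))).
exact: (dg_bicartesian D (bj : (b <= j)%N) jl).1.
Qed.

Lemma column_hom j k k' (mk : mono_sq l (reindex (column j) k))
    (mk' : mono_sq l (reindex (column j.+1) k')) :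
  (j < l)%N -> mono_index l k -> mono_index l k' ->
  (forall i, (i <= l)%N -> (k i <= k' i)%N /\ (k i <= j.+1)%N) ->
  exists f : hom (nch mk) (nch mk'), forall i, (i <= l)%N ->
    nc f i = cc (column j.+1) (k i) (k' i) \oc dg_hor D (k i) j.
Proof.
move=> jl kH k'H kk'.
have fL i : (i < l)%N ->
    cc (column j.+1) (k i.+1) (k' i.+1) \oc dg_hor D (k i.+1) j \oc
      sq_map (reindex (column j) k) i =
    sq_map (reindex (column j.+1) k') i \oc (cc (column j.+1) (k i) (k' i) \oc dg_hor D (k i) j).
  move=> il /=; have [kk1 kj1] := kk' i.+1 il; have [kk0 kj0] := kk' i (ltnW il).
  rewrite -comp_assoc hor_cc ?kH//.
  rewrite !comp_assoc cc_comp ?kH//; congr (_ \oc _); apply/esym.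
  by apply: cc_comp => //; exact: k'H.
by exists (mkh mk mk' fL) => i il; rewrite nc_mkh.
Qed.

(** These are the traces of the chosen representations, set to 0 beyond [l]; their adjointness is
    the correspondence of the first row with the maps of [S]. *)
Lemma diagram_traces : exists tr : forall j, dual (hom (S j) (dg_ob D 0 j)),
  (forall j, (j <= l)%N -> dualizes (tr j)) /\
  (forall j, (j < l)%N -> forall u : hom (S j.+1) (dg_ob D 0 j),
    tr j.+1 (dg_hor D 0 j \oc u) = tr j (u \oc sq_map S j)).
Proof.
have [tr trE] : exists tr : forall j, dual (hom (S j) (dg_ob D 0 j)),
    forall o : 'I_l.+1, tr o = stable_trace (dg_eta D o).
  exists (fun j => match @idP (j < l.+1)%N return dual (hom (S j) (dg_ob D 0 j)) with
    | ReflectT h => stable_trace (dg_eta D (Ordinal h)) | ReflectF _ => 0 end).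
  case=> i il /=; case: {-}_ / idP => [h|//].
  by rewrite (bool_irrelevance h il).
exists tr; split=> [j jl|j jl u].
  have jl' : (j < l.+1)%N by [].
  have := trE (Ordinal jl'); rewrite /= => ->; exact: represents_dualizes.
have := trE (ch_src (Ordinal jl)); have := trE (ch_tgt (Ordinal jl)) => /= -> ->.
exact: (corresponds_trace (f := sq_map S j) (ft := dg_hor D 0 j) u
  (dg_row0 (d := D) (j := Ordinal jl))).
Qed.

Lemma step_mono m v : mono_index l (step m v).
Proof. by move=> i _; rewrite /step; case: ifP; case: ifP => //; lia. Qed.

Lemma minn_mono a k : (forall i, (i <= l)%N -> k i = minn i a) -> mono_index l k.
Proof. by move=> kE i il; rewrite !kE ?(ltnW il)//; lia. Qed.

Lemma minnS_mono a k : (forall i, (i <= l)%N -> k i = (minn i a).+1) -> mono_index l k.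
Proof. by move=> kE i il; rewrite !kE ?(ltnW il)//; lia. Qed.

(** Either a stack of squares of the diagram, or a square whose vertical sides are identities. *)
Lemma hor_square_pushout j a b c d : (j < l)%N -> (a <= b)%N -> (b <= j.+1)%N ->
  (a = c /\ b = d) \/ (a = b /\ c = d) ->
  is_pushout (cc (column j.+1) a c \oc dg_hor D a j) (cc (column j) a b)
    (cc (column j.+1) c d) (cc (column j.+1) b d \oc dg_hor D b j).
Proof.
move=> jl ab bj [[<- <-]|[<- <-]].
  by rewrite !cc_id !comp_idl; exact: hor_pushout.
by rewrite !cc_id; exact: pushout_idv.
Qed.

Variable tr : forall j, dual (hom (S j) (dg_ob D 0 j)).
Hypothesis tr_dualizes : forall j, (j <= l)%N -> dualizes (tr j).
Hypothesis tr_hor : forall j, (j < l)%N -> forall u : hom (S j.+1) (dg_ob D 0 j),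
  tr j.+1 (dg_hor D 0 j \oc u) = tr j (u \oc sq_map S j).

(** [k] cuts out T_j, [kt] cuts out C_j, and [step j.+1 j.+1] gives Q_j(X~^{0,j}). The second clause
    fixes the trace on maps through Q_j(X~^{0,j}), which the next induction step needs for its
    compatibility; the outer [cc] in it are casts. *)
Lemma truncation_dualizes j k kt (mk : mono_sq l (reindex augment k))
    (mkt : mono_sq l (reindex (column j) kt))
    (mq : mono_sq l (reindex (column j) (step j.+1 j.+1))) :
  (j <= l)%N ->
  (forall i, (i <= l)%N -> k i = (minn i j).+1) ->
  (forall i, (i <= l)%N -> kt i = minn i j.+1) ->
  exists t : dual (hom (nch mk) (nch mkt)), dualizes t /\
    forall (psi : hom (nch mq) (nch mkt)) (phi : hom (nch mk) (nch mq)),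
      (forall i, (i <= l)%N -> nc psi i = cc (column j) (step j.+1 j.+1 i) (kt i)) ->
      t (psi \oc phi) =
      tr j (cc (column j) (step j.+1 j.+1 j) 0 \oc nc phi j \oc cc augment j.+1 (k j)).
Proof.
elim: j => [|j IH] in k kt mk mkt mq *; move=> jl kE ktE.
  (* T_0 is P_0(X^0) and C_0 is Q_0(X~^{0,0}). *)
  have [|||||||t [dt tE]] := @dualizes_reindex K F l augment (column 0) k kt mk mkt 0 1 0
    (tr 0) jl.
  - exact: minnS_mono kE.
  - exact: minn_mono ktE.
  - by [].
  - by move=> i il; rewrite kE//; lia.
  - by move=> i; rewrite leqn0 => /eqP ->; rewrite ktE.
  - move=> i /andP[i0 il]; rewrite ktE// (_ : minn i 1 = 1)%N; last lia.
    exact: dg_inj (leq_trans i0 il).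
  - exact: tr_dualizes.
  exists t; split=> // psi phi psiE; rewrite tE nc_comp// psiE//.
  have kt0 : kt 0 = 0%N by rewrite ktE.
  by rewrite comp_assoc (cc_comp (column 0)) ?[(_ <= 0)%N]kt0 ?kt0.
pose k1 i := (minn i j).+1; pose kt1 i := minn i j.+1.
have k1H : mono_index l k1 by apply: (@minnS_mono j).
have kt1H : mono_index l kt1 by apply: (@minn_mono j.+1).
have kH : mono_index l k by exact: minnS_mono kE.
have ktH : mono_index l kt by exact: minn_mono ktE.
have mk1 : mono_sq l (reindex augment k1).
  by apply: augment_reindex_mono => // i il; rewrite /k1; lia.
have mkt1 : mono_sq l (reindex (column j) kt1).
  by apply: column_reindex_mono (ltnW jl) _ _ => // i il; rewrite /kt1; lia.
have mq1 : mono_sq l (reindex (column j) (step j.+1 j.+1)).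
  apply: column_reindex_mono (ltnW jl) _ _; first exact: step_mono.
  by move=> i il; rewrite /step; case: ifP; lia.
have [t1 [dt1 t1E]] := IH k1 kt1 mk1 mkt1 mq1 (ltnW jl) (fun _ _ => erefl) (fun _ _ => erefl).
(* [mA], [mAt] and [mB] belong to P_{j+1}(X^j), Q_{j+1}(X~^{0,j}) and P_{j+1}(X^{j+1}), while [mq]
   belongs to Q_{j+1}(X~^{0,j+1}). *)
have mA : mono_sq l (reindex augment (step j.+1 j.+1)).
  apply: augment_reindex_mono; first exact: step_mono.
  by move=> i il; rewrite /step; case: ifP; lia.
have mAt : mono_sq l (reindex (column j) (step j.+2 j.+1)).
  apply: column_reindex_mono (ltnW jl) _ _; first exact: step_mono.
  by move=> i il; rewrite /step; case: ifP; lia.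
have mB : mono_sq l (reindex augment (step j.+1 j.+2)).
  apply: augment_reindex_mono; first exact: step_mono.
  by move=> i il; rewrite /step; case: ifP; lia.
have [|||||||tA [dtA tAE]] := @dualizes_reindex K F l augment (column j) _ _ mA mAt
    j.+1 j.+1 0 (tr j) jl.
- exact: step_mono.
- exact: step_mono.
- by move=> i ij; rewrite /step ij.
- by move=> i /andP[ji il]; rewrite /step ltnNge ji.
- by move=> i ij; rewrite /step ltnS ij.
- move=> i /andP[ji il]; rewrite /step ltnNge ji; exact: dg_inj.
- by apply: tr_dualizes; exact: ltnW.
have [|||||||tB [dtB tBE]] := @dualizes_reindex K F l augment (column j.+1) _ _ mB mq
    j.+1 j.+2 0 (tr j.+1) jl.
- exact: step_mono.
- exact: step_mono.
- by move=> i ij; rewrite /step ij.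
- by move=> i /andP[ji il]; rewrite /step ltnNge ji.
- by move=> i ij; rewrite /step ltnS ij.
- move=> i /andP[ji il]; rewrite /step ltnNge ji; apply: dg_inj; lia.
- exact: tr_dualizes.
have [v vE] : exists v : hom (nch mA) (nch mk1), forall i, (i <= l)%N ->
    nc v i = cc augment (step j.+1 j.+1 i) (k1 i).
  apply: reindex_hom => //; first exact: step_mono.
  by move=> i il; rewrite /step /k1; case: ifP; lia.
have [h hE] : exists h : hom (nch mA) (nch mB), forall i, (i <= l)%N ->
    nc h i = cc augment (step j.+1 j.+1 i) (step j.+1 j.+2 i).
  apply: reindex_hom; try exact: step_mono.
  by move=> i il; rewrite /step; case: ifP; lia.
have [w wE] : exists w : hom (nch mB) (nch mk), forall i, (i <= l)%N ->
    nc w i = cc augment (step j.+1 j.+2 i) (k i).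
  apply: reindex_hom => //; first exact: step_mono.
  by move=> i il; rewrite kE// /step; case: ifP; lia.
have [h' h'E] : exists h' : hom (nch mk1) (nch mk), forall i, (i <= l)%N ->
    nc h' i = cc augment (k1 i) (k i).
  by apply: reindex_hom => // i il; rewrite kE// /k1; lia.
have [vt vtE] : exists vt : hom (nch mAt) (nch mkt1), forall i, (i <= l)%N ->
    nc vt i = cc (column j) (step j.+2 j.+1 i) (kt1 i).
  apply: reindex_hom => //; first exact: step_mono.
  by move=> i il; rewrite /step /kt1; case: ifP; lia.
have [ht htE] : exists ht : hom (nch mAt) (nch mq), forall i, (i <= l)%N ->
    nc ht i = cc (column j.+1) (step j.+2 j.+1 i) (step j.+2 j.+2 i) \oc
      dg_hor D (step j.+2 j.+1 i) j.
  apply: column_hom => //; try exact: step_mono.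
  by move=> i il; rewrite /step; case: ifP; lia.
have [wt wtE] : exists wt : hom (nch mq) (nch mkt), forall i, (i <= l)%N ->
    nc wt i = cc (column j.+1) (step j.+2 j.+2 i) (kt i).
  apply: reindex_hom => //; first exact: step_mono.
  by move=> i il; rewrite ktE// /step; case: ifP; lia.
have [ht' ht'E] : exists ht' : hom (nch mkt1) (nch mkt), forall i, (i <= l)%N ->
    nc ht' i = cc (column j.+1) (kt1 i) (kt i) \oc dg_hor D (kt1 i) j.
  by apply: column_hom => // i il; rewrite ktE// /kt1; lia.
have Q (i : 'I_l.+1) : biproduct (ch_ob (nch mk1) i) (ch_ob (nch mB) i).
  exact: inhabited_witness ((pre_additive F).2 _ _).
have Qt (i : 'I_l.+1) : biproduct (ch_ob (nch mkt1) i) (ch_ob (nch mq) i).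
  exact: inhabited_witness ((pre_additive F).2 _ _).
(* Up to index j the horizontal maps are identities, beyond it the vertical ones are. *)
have po i : (i <= l)%N -> is_pushout (nc h i) (nc v i) (nc w i) (nc h' i).
  move=> il; rewrite hE// vE// wE// h'E//; apply: (cc_pushout augment).
  - by rewrite /step /k1; case: ifP; lia.
  - by rewrite /step; case: ifP; lia.
  - by rewrite kE// /step /k1; case: ifP; lia.
(* Up to index j + 1 these are stacks of squares of the diagram; beyond it the vertical maps are
   identities. *)
have pot i : (i <= l)%N -> is_pushout (nc ht i) (nc vt i) (nc wt i) (nc ht' i).
  move=> il; rewrite htE// vtE// wtE// ht'E//; apply: hor_square_pushout => //.
  - by rewrite /step /kt1; case: ifP; lia.
  - by rewrite /kt1; lia.
  - by rewrite ktE// /step /kt1; case: ifP; lia.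
have mv i : (i <= l)%N -> adm_mono (nc v i).
  move=> il; rewrite vE//; apply: (cc_mono augment_mono).
  - by rewrite /step /k1; case: ifP; lia.
  - by rewrite /k1; lia.
have mvt i : (i <= l)%N -> adm_mono (nc vt i).
  move=> il; rewrite vtE//; apply: (cc_mono (S := column j) (n := minn j.+1 l)).
  - by move=> a; exact: column_mono (ltnW jl).
  - by rewrite /step /kt1; case: ifP; lia.
  - by rewrite /kt1; lia.
have cf : conflation (bp_inl (chain_bp Q) \oc v + bp_inr (chain_bp Q) \oc h :
      hom (nch mA) (chain_bp Q : Morm F l))
    (w \oc bp_prr (chain_bp Q) - h' \oc bp_prl (chain_bp Q)).
  by apply: chain_pushout_conflation => i; rewrite !ncE; [apply: po | apply: mv];
    rewrite -ltnS.
have cft : conflation (bp_inl (chain_bp Qt) \oc vt + bp_inr (chain_bp Qt) \oc ht :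
      hom (nch mAt) (chain_bp Qt : Morm F l))
    (wt \oc bp_prr (chain_bp Qt) - ht' \oc bp_prl (chain_bp Qt)).
  by apply: chain_pushout_conflation => i; rewrite !ncE; [apply: pot | apply: mvt];
    rewrite -ltnS.
have [tS [dtS tSE]] := @dualizes_biproduct K (Morm F l) _ _ _ _ (chain_bp Q) (chain_bp Qt)
  _ _ dt1 dtB.
(* [vt] factors through Q_j(X~^{0,j}), where the induction hypothesis computes [t1] from the
   component at [j]. [tA] reads the component at [j.+1], and the ladder equation of [phi] relates
   the two. *)
have compat1 phi : t1 (vt \oc phi) = tA (phi \oc v).
  have [psi psiE] : exists psi : hom (nch mq1) (nch mkt1), forall i, (i <= l)%N ->
      nc psi i = cc (column j) (step j.+1 j.+1 i) (kt1 i).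
    apply: reindex_hom => //; first exact: step_mono.
    by move=> i il; rewrite /step /kt1; case: ifP; lia.
  have [kap kapE] : exists kap : hom (nch mAt) (nch mq1), forall i, (i <= l)%N ->
      nc kap i = cc (column j) (step j.+2 j.+1 i) (step j.+1 j.+1 i).
    apply: reindex_hom; try exact: step_mono.
    by move=> i il; rewrite /step; case: ifP; case: ifP; lia.
  have vtpsi : vt = psi \oc kap.
    apply: nc_ext => i il; rewrite nc_comp// psiE// kapE// vtE// (cc_comp (column j))//.
      by rewrite /step; case: ifP; case: ifP; lia.
    by rewrite /step /kt1; case: ifP; lia.
  rewrite vtpsi -comp_assoc (t1E _ _ psiE) tAE !nc_comp ?(ltnW jl)// kapE ?(ltnW jl)// vE//.
  have e1 : cc (column j) (step j.+2 j.+1 j) 0 \oc nc phi j \oc cc augment j.+1 (k1 j) =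
      cc (column j) (step j.+2 j.+1 j.+1) 0 \oc nc phi j.+1 \oc cc augment j.+1 (k1 j.+1).
    apply: cc_slide; last exact: (nc_ladder phi jl).
      by rewrite /k1; lia.
    by rewrite /step; case: ifP; case: ifP; lia.
  transitivity (tr j (cc (column j) (step j.+2 j.+1 j) 0 \oc nc phi j \oc cc augment j.+1 (k1 j))).
    congr (tr j (_ \oc _)); rewrite comp_assoc; congr (_ \oc _).
    by apply: (cc_comp (column j)); rewrite /step; do ?case: ifP; lia.
  rewrite e1 -!comp_assoc; congr (tr j (_ \oc (_ \oc _))); apply/esym.
  by apply: (@cc_comp _ _ augment j.+1 (step j.+1 j.+1 j.+1) (k1 j.+1));
    rewrite /step /k1; case: ifP; lia.
(* Both traces read the component at [j.+1], so this is [tr_hor]. *)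
have compat2 phi : tB (ht \oc phi) = tA (phi \oc h).
  rewrite tBE tAE !nc_comp// htE// hE//.
  pose u := cc (column j) (step j.+2 j.+1 j.+1) 0 \oc nc phi j.+1 \oc
    cc augment j.+2 (step j.+1 j.+2 j.+1).
  transitivity (tr j.+1 (dg_hor D 0 j \oc u)).
    rewrite /u !comp_assoc; congr (tr j.+1 (_ \oc _ \oc _)).
    rewrite (hor_cc jl)//; last by rewrite /step; case: ifP; lia.
    congr (_ \oc _).
    by apply: (@cc_comp _ _ (column j.+1) (step j.+2 j.+1 j.+1) (step j.+2 j.+2 j.+1) 0);
      rewrite /step; do ?case: ifP; lia.
  rewrite tr_hor// /u -!comp_assoc; congr (tr j (_ \oc (_ \oc _))).
  transitivity (cc augment j.+1 (step j.+1 j.+2 j.+1)); last first.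
    apply/esym.
    by apply: (@cc_comp _ _ augment j.+1 (step j.+1 j.+1 j.+1) (step j.+1 j.+2 j.+1));
      rewrite /step; do ?case: ifP; lia.
  rewrite -[sq_map S j]/(sq_map augment j.+1) -cc1.
  by apply: (@cc_comp _ _ augment j.+1 j.+2 (step j.+1 j.+2 j.+1));
    rewrite // /step; case: ifP; lia.
have [|t [dt tE]] := dualizes_cone (chain_frobenius F l) cf cft dtA dtS.
  move=> q; rewrite tSE.
  have -> : bp_prl (chain_bp Qt) \oc ((bp_inl (chain_bp Qt) \oc vt +
      bp_inr (chain_bp Qt) \oc ht) \oc q) = vt \oc q.
    by rewrite comp_assoc compDr !comp_assoc bp_ll bp_lr comp0l comp_idl addr0.
  have -> : bp_prr (chain_bp Qt) \oc ((bp_inl (chain_bp Qt) \oc vt +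
      bp_inr (chain_bp Qt) \oc ht) \oc q) = ht \oc q.
    by rewrite comp_assoc compDr !comp_assoc bp_rr bp_rl comp0l comp_idl add0r.
  by rewrite -(comp_assoc vt) -(comp_assoc ht) compat1 compat2 -!comp_assoc compDr linearD.
exists t; split=> // psi phi psiE.
(* As [psi] is [wt], the map factors through the second map of [cft] by way of the summand [bp_inr],
   so only [tB] contributes to its trace. *)
have -> : psi \oc phi = (wt \oc bp_prr (chain_bp Qt) - ht' \oc bp_prl (chain_bp Qt)) \oc
    (bp_inr (chain_bp Qt) \oc phi).
  have -> : psi = wt by apply: nc_ext => i il; rewrite psiE// wtE.
  rewrite comp_assoc compBl -!comp_assoc bp_rr bp_lr comp0r subr0.
  by rewrite comp_idr.
rewrite tE tSE.
have -> : bp_prl (chain_bp Qt) \oc (bp_inr (chain_bp Qt) \oc phi \oc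
    (w \oc bp_prr (chain_bp Q) - h' \oc bp_prl (chain_bp Q))) \oc bp_inl (chain_bp Q) = 0.
  by rewrite !comp_assoc bp_lr !comp0l.
have -> : bp_prr (chain_bp Qt) \oc (bp_inr (chain_bp Qt) \oc phi \oc
    (w \oc bp_prr (chain_bp Q) - h' \oc bp_prl (chain_bp Q))) \oc bp_inr (chain_bp Q) =
    phi \oc w.
  rewrite !comp_assoc bp_rr comp_idl -comp_assoc compBl -!comp_assoc bp_rr bp_lr.
  by rewrite comp0r subr0 comp_idr.
rewrite linear0 add0r tBE nc_comp// wE// -!comp_assoc.
congr (tr j.+1 (_ \oc (_ \oc _))).
by apply: (@cc_comp _ _ augment j.+2 (step j.+1 j.+2 j.+1) (k j.+1));
  rewrite ?kE// /step; case: ifP; lia.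
Qed.

End Diagram.

(** * Existence of the diagram *)

Section Existence.
Context (K : fieldType) (F : frobeniusCat K) (l : nat).

(** Row i + 1 begins on the diagonal with an injective hull of [A i], the future I^i, and proceeds
    to the right by pushouts, which keep the vertical maps admissible monics. *)
Lemma next_row i (A : sequence F) : exists (B : sequence F) (v : forall j, hom (A j) (B j)),
  [/\ injective_ob (B i), forall j, (i <= j <= l)%N -> adm_mono (v j) &
      forall j, (i <= j < l)%N -> is_pushout (sq_map A j) (v j) (v j.+1) (sq_map B j)].
Proof.
have /choice_dep[hull hullP] : forall j, exists x : {B : F & hom (A j) B},
    injective_ob (tag x) /\ adm_mono (tagged x).
  by move=> j; have [B [v Bv]] := enough_injectives (A j); exists (existT _ B v).
pose R j (x : {B : F & hom (A j) B}) (y : {B : F & hom (A j.+1) B}) :=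
  exists h, is_pushout (sq_map A j) (tagged x) (tagged y) h.
have [||x [x0 xP]] := dependent_recursion (x0 := hull)
  (P := fun j x => adm_mono (tagged x)) (R := R) (j := i) (n := l).
- exact: (hullP i).2.
- move=> j [B v] _ /= mv.
  have [B' [v' [h [po mv']]]] := adm_mono_pushout (exactP F) (sq_map A j) mv.
  by exists (existT _ B' v'); split=> //; exists h.
have /choice_dep[h hP] : forall j, exists h, (i <= j < l)%N ->
    is_pushout (sq_map A j) (tagged (x j)) (tagged (x j.+1)) h.
  move=> j; have [ij|] := boolP (i <= j < l)%N; last by exists 0.
  by have [h hP] := (xP j ij).2; exists h.
exists (Sequence h), (fun j => tagged (x j)); split=> //=.
- by rewrite x0//; exact: (hullP i).1.
- move=> j /andP[]; rewrite leq_eqVlt => /orP[/eqP <- _|ij jl].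
    by rewrite x0//; exact: (hullP i).2.
  by case: j ij jl => // j ij jl; apply: (xP j _).1; rewrite -ltnS ij.
Qed.

(** Representing objects and corresponding maps form row 0, and [next_row] is iterated. Its squares
    are bicartesian because a pushout along an admissible monic is also a pullback. *)
Lemma dual_diagram_exists (S : sequence F) (mS : mono_sq l S) :
  (forall A : stable F, representable A) -> inhabited (dual_diagram (nch mS)).
Proof.
move=> F_rep.
have /choice_dep[At etaP] : forall i, exists At : F,
    inhabited (@represents K (stable F) (S i) At).
  by move=> i; have [At eta] := F_rep (S i); exists At.
pose eta i := inhabited_witness (etaP i).
have /choice_dep[beta betaP] : forall i, exists b : hom (At i) (At i.+1),
    corresponds (eta i) (eta i.+1) (stable_cl (sq_map S i)) (stable_cl b).
  move=> i; have [ft ftP] := corresponds_ex (eta i) (eta i.+1) (stable_cl (sq_map S i)).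
  by have [b bE] := stable_clP ft; exists b; rewrite -bE.
have /choice_dep[next /choice_dep[ver verP]] := fun iA : nat * sequence F => next_row iA.1 iA.2.
pose fix row i := if i is i'.+1 then next (i', row i') else Sequence beta.
split.
apply: (@DualDiagram K F l (nch mS) (fun i j => row i j) (fun i j => sq_map (row i) j)
  (fun i j => ver (i, row i) j) _ _ _ (fun j => eta j)).
- by move=> j jl /=; have [] := verP (j, row j).
- by move=> i j ij jl il; have [_ mv _] := verP (i, row i); apply: mv; rewrite /= ij.
- move=> i j ij jl; have [_ mv po] := verP (i, row i).
  have /po po' : (i <= j < l)%N by rewrite ij.
  by split=> //; apply: pushout_pullback => //; apply: mv; rewrite /= ij ltnW.
- move=> j; exact: betaP.
Qed.

Lemma nch_eq (S S' : sequence F) (mS : mono_sq l S) (mS' : mono_sq l S') :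
  S = S' -> nch mS = nch mS'.
Proof. by move=> e; subst S'; congr nch; exact: Prop_irrelevance. Qed.

(** The case j = l of the induction: T_l is the chain itself and C_l is the last column. *)
Lemma last_column_represents (S : sequence F) (mS : mono_sq l S)
    (D : dual_diagram (nch mS)) :
  inhabited (@represents K (stable (Morm F l)) (nch mS) (last_column D)).
Proof.
have [Z Z0] := (pre_additive F).1.
have [tr [tr_dual tr_hor]] := diagram_traces D.
(* [succn] undoes the index shift of [augment]. *)
have mk : mono_sq l (reindex (augment S Z) succn).
  by apply: augment_reindex_mono => //; exact: mS.
have mkt : mono_sq l (reindex (column D l) id).
  by apply: column_reindex_mono => // i il; rewrite leq_min leqW.
(* Every index up to [l] goes to 0, so this is the constant chain on X~^{0,l}; the value [l.+1] is
   not reached. *)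
have mq : mono_sq l (reindex (column D l) (step l.+1 l.+1)).
  apply: column_reindex_mono => //; first exact: step_mono.
  by move=> i il; rewrite /step ltnS il.
have [||t [dt _]] := truncation_dualizes Z0 tr_dual tr_hor mk mkt mq (leqnn l).
- by move=> i il; rewrite (minn_idPl il).
- by move=> i il; rewrite (minn_idPl (leqW il)).
have : inhabited (@represents K (stable (Morm F l)) (nch mk) (nch mkt)).
  exact: dualizes_represents dt.
have -> : nch mk = nch mS.
  apply: nch_eq; case: S {mS D tr tr_dual tr_hor mk mkt mq t dt} => ob map.
  by congr Sequence; apply: functional_extensionality_dep => i; rewrite cc1.
suff -> : nch mkt = last_column D by [].
have mc : mono_sq l (column D l) by move=> i il; apply: dg_ver_mono => //; exact: ltnW.
transitivity (nch mc).
  by apply: nch_eq; congr Sequence; apply: functional_extensionality_dep => i; rewrite cc1.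
by congr Chain; exact: Prop_irrelevance.
Qed.

End Existence.

Theorem theorem5 (K : fieldType) (F : frobeniusCat K) (l : nat)
    (F_fin : hom_finite (stable F))
    (F_rep : forall A : stable F, representable A)
    (X : stable (Morm F l)) :
  [/\ representable X,
      inhabited (dual_diagram X) &
      forall D : dual_diagram X, inhabited (represents X (last_column D))].
Proof.
elim/(@nch_ind K F l): X => S mS.
have diag := dual_diagram_exists mS F_rep.
split=> //; last exact: last_column_represents.
by have [D] := diag; exists (last_column D); exact: last_column_represents.
Qed.
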